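(* Let $h$ be an invertible hermitian form on the right $S^3_q$-module $\Omega^1(S^3_q)$ and write $h_{ab}=h(\omega_a,\omega_b)$ for $a,b\in\{+,-,z\}$. A $q$-affine Levi-Civita connection on $\Omega^1(S^3_q)$ (with respect to $h$) exists if and only if $$X_z\big(h_{++}-q^2h_{--}\big)=K^2X_-(h_{z+})-q^2X_-(h_{-z})-q^2K^2X_+(h_{z-})+X_+(h_{+z}).$$
   Context: Let $q>0$ be real, $q\neq 1$. $S^3_q$ is the unital complex $*$-algebra generated by $a,a^*,c,c^*$ with relations $ac=qca$, $c^*a^*=qa^*c^*$, $ac^*=qc^*a$, $ca^*=qa^*c$, $cc^*=c^*c$, $a^*a+c^*c=aa^*+q^2cc^*=\mathbf 1$. $\mathcal U_q(\mathrm{su}(2))$ is the algebra generated by $E,F,K,K^{-1}$ with $K^{\pm1}E=q^{\pm1}EK^{\pm1}$, $K^{\pm1}F=q^{\mp1}FK^{\pm1}$, $[E,F]=\frac{K^2-K^{-2}}{q-q^{-1}}$, and coproduct $\Delta(E)=E\otimes K+K^{-1}\otimes E$, $\Delta(F)=F\otimes K+K^{-1}\otimes F$, $\Delta(K^{\pm1})=K^{\pm1}\otimes K^{\pm1}$ (counit $\epsilon(K)=1$, $\epsilon(E)=\epsilon(F)=0$). It acts on $S^3_q$ from the left; the action is written $h(f)$ (or $h\triangleright f$), makes $S^3_q$ a left module algebra, $h(fg)=h_{(1)}(f)\,h_{(2)}(g)$ and $h(\mathbf 1)=\epsilon(h)\mathbf 1$, and is determined by $K^{\pm1}(a)=q^{\mp1/2}a$,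 $K^{\pm1}(c)=q^{\mp1/2}c$, $K^{\pm1}(a^* )=q^{\pm1/2}a^*$, $K^{\pm1}(c^* )=q^{\pm1/2}c^*$; $E(a)=-qc^*$, $E(c)=a^*$, $E(a^* )=E(c^* )=0$; $F(a)=F(c)=0$, $F(a^* )=c$, $F(c^* )=-q^{-1}a$. Set $X_+=\sqrt q\,EK$, $X_-=\frac1{\sqrt q}FK$, $X_z=\frac{1-K^4}{1-q^{-2}}$, and $\sigma_+=\sigma_-=K^2$, $\sigma_z=K^4$, all acting on $S^3_q$ by the left action; then $X_a(fg)=fX_a(g)+X_a(f)\sigma_a(g)$ for $a\in\{+,-,z\}$. The quantum tangent space $TS^3_q$ is the complex vector space spanned by $X_+,X_-,X_z$. An expression such as $K^2X_-(f)$ means $K^2\triangleright(X_-\triangleright f)$. $\Omega^1(S^3_q)$ is the left covariant first order differential calculus on $S^3_q$: the $S^3_q$-bimodule that is free as a left module with basis $\omega_+=a\,dc-qc\,da$, $\omega_-=c^*da^*-qa^*dc^*$, $\omega_z=a^*da+c^*dc$, with bimodule relations $\omega_za=q^{-2}a\omega_z$, $\omega_za^*=q^2a^*\omega_z$, $\omega_zc=q^{-2}c\omega_z$, $\omega_zc^*=q^2c^*\omega_z$, $\omega_\pm a=q^{-1}a\omega_\pm$, $\omega_\pm a^*=qa^*\omega_\pm$, $\omega_\pm c=q^{-1}c\omega_\pm$, $\omega_\pm c^*=qc^*\omega_\pm$, and differential $df=X_+(f)\omega_++X_-(f)\omega_-+X_z(f)\omega_z$. Only the right module structure is used here; as a right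 $S^3_q$-module, $\Omega^1(S^3_q)$ is free of rank 3 with basis $\omega_+,\omega_-,\omega_z$. A right $q$-affine connection on a right $S^3_q$-module $M$ is a map $\nabla:TS^3_q\times M\to M$, $(X,m)\mapsto\nabla_Xm$, that is $\mathbb C$-linear in each argument and satisfies $\nabla_{X_a}(mf)=(\nabla_{X_a}m)\sigma_a(f)+mX_a(f)$ for $a\in\{+,-,z\}$, $m\in M$, $f\in S^3_q$. Write $\nabla_a=\nabla_{X_a}$. A hermitian form on a right $S^3_q$-module $M$ is a map $h:M\times M\to S^3_q$ with $h(m_1,m_2f)=h(m_1,m_2)f$, $h(m_1,m_2)^*=h(m_2,m_1)$ and $h(m_1+m_2,m_3)=h(m_1,m_3)+h(m_2,m_3)$. It is invertible if the map $\hat h:M\to M^*$ (dual module), $\hat h(m_1)(m_2)=h(m_1,m_2)$, is bijective. $\nabla$ is compatible with $h$ if for all $m_1,m_2\in M$: $X_+(h(m_1,m_2))=h(m_1,\nabla_{X_+}m_2)-K^2\big(h(\nabla_{X_-}m_1,m_2)\big)$, $X_-(h(m_1,m_2))=h(m_1,\nabla_{X_-}m_2)-K^2\big(h(\nabla_{X_+}m_1,m_2)\big)$, $X_z(h(m_1,m_2))=h(m_1,\nabla_{X_z}m_2)-K^4\big(h(\nabla_{X_z}m_1,m_2)\big)$. A $q$-affine connection $\nabla$ on $\Omega^1(S^3_q)$ is torsion free if $\nabla_-\omega_+-q^2\nabla_+\omega_-=\omega_z$, $q^2\nabla_z\omega_--q^{-2}\nabla_-\omega_z=(1+q^2)\omega_-$,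 $q^2\nabla_+\omega_z-q^{-2}\nabla_z\omega_+=(1+q^2)\omega_+$. A $q$-affine Levi-Civita connection on $\Omega^1(S^3_q)$ with respect to $h$ is a right $q$-affine connection on $\Omega^1(S^3_q)$ that is torsion free and compatible with $h$. *)

(* Defs.v *)
From HB Require Import structures.
From mathcomp Require Import all_boot all_order all_algebra.
From mathcomp Require Import generic_quotient.
From mathcomp Require Import boolp reals.
From mathcomp Require Import complex.
From mathcomp Require Import ring lra.

Set Implicit Arguments.
Unset Strict Implicit.
Unset Printing Implicit Defensive.

Import Order.TTheory GRing.Theory Num.Theory.
Local Open Scope ring_scope.
Local Open Scope quotient_scope.

(* Unital associative algebras presented by generators and relations: the     *)
(* formal algebraic expressions in the generators, modulo the least           *)
(* congruence containing the algebra axioms and the given relations.          *)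

Inductive pterm (C I : Type) : Type :=
| Const (k : C)
| Gen of I
| Add of pterm C I & pterm C I
| Mul of pterm C I & pterm C I.
Arguments Const {C I} k%_R.
Arguments Gen {C I}.

HB.instance Definition _ (C I : Type) := gen_eqMixin (pterm C I).
HB.instance Definition _ (C I : Type) := gen_choiceMixin (pterm C I).

Definition Scale (C I : Type) (k : C) (t : pterm C I) := Mul (Const k) t.

Declare Scope pterm_scope.
Delimit Scope pterm_scope with PT.
Arguments Scale {C I} k%_R t%_PT.
Notation "t + u" := (Add t u) : pterm_scope.
Notation "t * u" := (Mul t u) : pterm_scope.
Notation "k *: t" := (Scale k t) : pterm_scope.
Notation "1" := (Const 1%R) : pterm_scope.

Section Presented.
Context (C : comNzRingType) (I : Type).
Context (rel : pterm C I -> pterm C I -> Prop).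
Implicit Types (t u v : pterm C I) (k l : C).

Inductive cong : pterm C I -> pterm C I -> Prop :=
| cong_rel t u : rel t u -> cong t u
| cong_refl t : cong t t
| cong_sym t u : cong t u -> cong u t
| cong_trans t u v : cong t u -> cong u v -> cong t v
| cong_add t t' u u' : cong t t' -> cong u u' -> cong (t + u)%PT (t' + u')%PT
| cong_mul t t' u u' : cong t t' -> cong u u' -> cong (t * u)%PT (t' * u')%PT
| cong_addA t u v : cong (t + (u + v))%PT ((t + u) + v)%PT
| cong_addC t u : cong (t + u)%PT (u + t)%PT
| cong_add0 t : cong (Const 0 + t)%PT t
| cong_addN t : cong ((- 1) *: t + t)%PT (Const 0)
| cong_mulA t u v : cong (t * (u * v))%PT ((t * u) * v)%PT
| cong_mul1l t : cong (1 * t)%PT t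
| cong_mul1r t : cong (t * 1)%PT t
| cong_mulDl t u v : cong ((t + u) * v)%PT (t * v + u * v)%PT
| cong_mulDr t u v : cong (t * (u + v))%PT (t * u + t * v)%PT
| cong_constD k l : cong (Const (k + l)) (Const k + Const l)%PT
| cong_constM k l : cong (Const (k * l)) (Const k * Const l)%PT
| cong_constC k t : cong (Const k * t)%PT (t * Const k)%PT.

Definition congb t u : bool := `[< cong t u >].

Lemma congb_refl : reflexive congb.
Proof. by move=> t; apply/asboolP; apply: cong_refl. Qed.

Lemma congb_sym : symmetric congb.
Proof. by move=> t u; apply/asboolP/asboolP; apply: cong_sym. Qed.

Lemma congb_trans : transitive congb.
Proof. by move=> t u v /asboolP tu /asboolP uv; apply/asboolP; apply: cong_trans uv. Qed.

Canonical cong_equiv := EquivRel congb congb_refl congb_sym congb_trans.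

Definition presented : Type := {eq_quot congb}.
HB.instance Definition _ := Choice.on presented.
HB.instance Definition _ := Quotient.on presented.

Definition pclass (t : pterm C I) : presented := \pi_presented t.

Lemma pclassP t u : pclass t = pclass u <-> cong t u.
Proof.
split; first by move/eqP; rewrite (eqmodE congb) => /asboolP.
by move=> tu; apply/eqP; rewrite (eqmodE congb); apply/asboolP.
Qed.

Lemma repr_cong t : cong (repr (pclass t)) t.
Proof. by apply/pclassP; rewrite /pclass reprK. Qed.

Lemma pclassK (x : presented) : pclass (repr x) = x.
Proof. exact: reprK. Qed.

Lemma presentedW (P : presented -> Prop) :
  (forall t, P (pclass t)) -> forall x, P x.
Proof. by move=> Pt x; rewrite -(pclassK x). Qed.

Definition pzero := pclass (Const 0).
Definition pone := pclass (Const 1).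
Definition padd (x y : presented) := pclass (repr x + repr y)%PT.
Definition pmul (x y : presented) := pclass (repr x * repr y)%PT.
Definition pscale k (x : presented) := pclass (k *: repr x)%PT.
Definition popp (x : presented) := pscale (- 1) x.

Lemma pclassD t u : pclass (t + u)%PT = padd (pclass t) (pclass u).
Proof. by apply/pclassP/cong_sym/cong_add; apply: repr_cong. Qed.

Lemma pclassM t u : pclass (t * u)%PT = pmul (pclass t) (pclass u).
Proof. by apply/pclassP/cong_sym/cong_mul; apply: repr_cong. Qed.

Lemma pclassZ k t : pclass (k *: t)%PT = pscale k (pclass t).
Proof.
by apply/pclassP/cong_sym/cong_mul; [apply: cong_refl|apply: repr_cong].
Qed.

Lemma paddA : associative padd.
Proof.
elim/presentedW=> t; elim/presentedW=> u; elim/presentedW=> v.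
by rewrite -!pclassD; apply/pclassP/cong_addA.
Qed.

Lemma paddC : commutative padd.
Proof.
elim/presentedW=> t; elim/presentedW=> u.
by rewrite -!pclassD; apply/pclassP/cong_addC.
Qed.

Lemma padd0 : left_id pzero padd.
Proof. by elim/presentedW=> t; rewrite -pclassD; apply/pclassP/cong_add0. Qed.

Lemma paddN : left_inverse pzero popp padd.
Proof.
elim/presentedW=> t; rewrite /popp -pclassZ -pclassD.
exact/pclassP/cong_addN.
Qed.

HB.instance Definition _ := GRing.isZmodule.Build presented paddA paddC padd0 paddN.

Lemma pclass_add t u : pclass (t + u)%PT = pclass t + pclass u.
Proof. exact: pclassD. Qed.

Lemma pmulA : associative pmul.
Proof.
elim/presentedW=> t; elim/presentedW=> u; elim/presentedW=> v.
by rewrite -!pclassM; apply/pclassP/cong_mulA.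
Qed.

Lemma pmul1l : left_id pone pmul.
Proof. by elim/presentedW=> t; rewrite -pclassM; apply/pclassP/cong_mul1l. Qed.

Lemma pmul1r : right_id pone pmul.
Proof. by elim/presentedW=> t; rewrite -pclassM; apply/pclassP/cong_mul1r. Qed.

Lemma pmulDl : left_distributive pmul +%R.
Proof.
elim/presentedW=> t; elim/presentedW=> u; elim/presentedW=> v.
by rewrite -pclass_add -!pclassM -pclass_add; apply/pclassP/cong_mulDl.
Qed.

Lemma pmulDr : right_distributive pmul +%R.
Proof.
elim/presentedW=> t; elim/presentedW=> u; elim/presentedW=> v.
by rewrite -pclass_add -!pclassM -pclass_add; apply/pclassP/cong_mulDr.
Qed.

HB.instance Definition _ :=
  GRing.Zmodule_isPzRing.Build presented pmulA pmul1l pmul1r pmulDl pmulDr.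

Lemma pscaleE k (x : presented) : pscale k x = pclass (Const k) * x.
Proof. by elim/presentedW: x => t; rewrite -pclassZ pclassM. Qed.

Lemma pconstD k l :
  pclass (Const (k + l)) = pclass (Const k) + pclass (Const l).
Proof. by rewrite -[RHS]pclassD; apply/pclassP/cong_constD. Qed.

Lemma pconstM k l :
  pclass (Const (k * l)) = pclass (Const k) * pclass (Const l).
Proof. by rewrite -[RHS]pclassM; apply/pclassP/cong_constM. Qed.

Lemma pscaleA k l (x : presented) : pscale k (pscale l x) = pscale (k * l) x.
Proof. by rewrite !pscaleE pconstM mulrA. Qed.

Lemma pscale1 : left_id 1 pscale.
Proof. by move=> x; rewrite pscaleE [LHS]mul1r. Qed.

Lemma pscaleDr : right_distributive pscale +%R.
Proof. by move=> k x y; rewrite !pscaleE mulrDr. Qed.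

Lemma pscaleDl (x : presented) :
  {morph pscale^~ x : k l / k + l >-> k + l}.
Proof. by move=> k l; rewrite !pscaleE pconstD mulrDl. Qed.

HB.instance Definition _ :=
  GRing.Zmodule_isLmodule.Build C presented pscaleA pscale1 pscaleDr pscaleDl.

Lemma pscaleAl k (x y : presented) : k *: (x * y) = (k *: x) * y.
Proof. by rewrite [LHS]pscaleE [k *: x]pscaleE mulrA. Qed.

Lemma pscaleAr k (x y : presented) : k *: (x * y) = x * (k *: y).
Proof.
rewrite [LHS]pscaleE [k *: y]pscaleE !mulrA; congr (_ * _).
elim/presentedW: x => t; rewrite -[LHS]pclassM -[RHS]pclassM.
exact/pclassP/cong_constC.
Qed.

End Presented.

Section Eval.
Context (C : comNzRingType) (I : Type) (A : algType C) (ev : I -> A).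

Fixpoint teval (t : pterm C I) : A :=
  match t with
  | Const k => k%:A
  | Gen g => ev g
  | Add t u => teval t + teval u
  | Mul t u => teval t * teval u
  end.

Lemma teval_cong (rel : pterm C I -> pterm C I -> Prop) :
  (forall t u, rel t u -> teval t = teval u) ->
  forall t u, cong rel t u -> teval t = teval u.
Proof.
move=> evrel t u; elim=> {t u} //=.
- by move=> t u v _ -> _ ->.
- by move=> t t' u u' _ -> _ ->.
- by move=> t t' u u' _ -> _ ->.
- by move=> *; rewrite addrA.
- by move=> *; rewrite addrC.
- by move=> *; rewrite scale0r add0r.
- by move=> *; rewrite scaleN1r mulN1r addNr scale0r.
- by move=> *; rewrite mulrA.
- by move=> *; rewrite scale1r mul1r.
- by move=> *; rewrite scale1r mulr1.
- by move=> *; rewrite mulrDl.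
- by move=> *; rewrite mulrDr.
- by move=> *; rewrite scalerDl.
- by move=> *; rewrite -scalerAl mul1r scalerA.
- by move=> *; rewrite -scalerAl -scalerAr mul1r mulr1.
Qed.

(* The algebra morphism out of a presented algebra determined by the images   *)
(* of the generators; meaningful when ev satisfies the relations (pliftP).    *)
Definition plift (rel : pterm C I -> pterm C I -> Prop) (x : presented rel) : A :=
  teval (repr x).

Lemma pliftP (rel : pterm C I -> pterm C I -> Prop) :
  (forall t u, rel t u -> teval t = teval u) ->
  forall t, plift (pclass rel t) = teval t.
Proof. by move=> evrel t; apply: (teval_cong evrel); apply: repr_cong. Qed.

End Eval.

Record qparam (R : realType) := QParam {
  qval :> R;
  qval_gt0 : 0 < qval;
  qval_neq1 : qval != 1
}.

Section Scalars.
Context (R : realType) (q : qparam R).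

Definition qC : R[i] := (qval q)%:C%C.
Definition sqrtqC : R[i] := (Num.sqrt (qval q))%:C%C.

Lemma sqrtqC2 : sqrtqC * sqrtqC = qC.
Proof. by rewrite -rmorphM /= -expr2 sqr_sqrtr // ltW ?qval_gt0. Qed.

Lemma qC_neq0 : qC != 0.
Proof. by rewrite -[0]/(0%:C%C) (inj_eq (fmorph_inj _)) gt_eqF ?qval_gt0. Qed.

Lemma sqrtqC_neq0 : sqrtqC != 0.
Proof. by apply: contra_neq qC_neq0; rewrite -sqrtqC2 => ->; rewrite mul0r. Qed.

Lemma qC2_neq1 : qC ^+ 2 != 1.
Proof.
rewrite sqrf_eq1 negb_or -[1]/(1%:C%C) -rmorphN !(inj_eq (fmorph_inj _)).
rewrite qval_neq1 /= gt_eqF //.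
by apply: lt_trans (qval_gt0 q); rewrite oppr_lt0.
Qed.

Lemma conj_qC : qC^* = qC.
Proof. by apply/CrealP; rewrite complex_real. Qed.

End Scalars.

(* The quantum sphere S^3_q: generators a, a^*, c, c^*. *)
Inductive s3gen := Ga | Gas | Gc | Gcs.

(* The quantised enveloping algebra U_q(su(2)): generators E, F, K, K^-1. *)
Inductive ugen := GE | GF | GK | GKi.

Section QuantumAlgebras.
Context (R : realType) (q : qparam R).
Local Notation C := R[i].
Local Notation q' := (qC q).
Local Notation s := (sqrtqC q).

Section Relations.
Local Notation a := (Gen Ga).
Local Notation a' := (Gen Gas).
Local Notation c := (Gen Gc).
Local Notation c' := (Gen Gcs).
Local Notation E := (Gen GE).
Local Notation F := (Gen GF).
Local Notation K := (Gen GK).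
Local Notation Ki := (Gen GKi).
Local Open Scope pterm_scope.

Inductive s3rel : pterm C s3gen -> pterm C s3gen -> Prop :=
| s3rel_ac   : s3rel (a * c) (q' *: (c * a))
| s3rel_csas : s3rel (c' * a') (q' *: (a' * c'))
| s3rel_acs  : s3rel (a * c') (q' *: (c' * a))
| s3rel_cas  : s3rel (c * a') (q' *: (a' * c))
| s3rel_ccs  : s3rel (c * c') (c' * c)
| s3rel_asa  : s3rel (a' * a + c' * c) 1
| s3rel_aas  : s3rel (a * a' + (q' ^+ 2)%R *: (c * c')) 1.

Inductive urel : pterm C ugen -> pterm C ugen -> Prop :=
| urel_KKi : urel (K * Ki) 1
| urel_KiK : urel (Ki * K) 1
| urel_KE  : urel (K * E) (q' *: (E * K))
| urel_KiE : urel (Ki * E) (q'^-1%R *: (E * Ki))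
| urel_KF  : urel (K * F) (q'^-1%R *: (F * K))
| urel_KiF : urel (Ki * F) (q' *: (F * Ki))
| urel_EF  : urel (E * F + (- 1) *: (F * E))
                  ((q' - q'^-1)^-1%R *: (K * K + (- 1) *: (Ki * Ki))).

End Relations.

Lemma teval_neq0 (I : Type) (rel : pterm C I -> pterm C I -> Prop) (ev : I -> C) :
  (forall t u, rel t u -> teval (A := C^o) ev t = teval (A := C^o) ev u) ->
  1 != 0 :> presented rel.
Proof.
move=> evrel; apply/eqP => /pclassP /(teval_cong evrel) /=.
by rewrite scale0r scale1r => /eqP; rewrite oner_eq0.
Qed.

Definition S3q : Type := presented s3rel.
HB.instance Definition _ := GRing.PzRing.on S3q.
HB.instance Definition _ := GRing.Lmodule.on S3q.

Lemma S3q_neq0 : 1 != 0 :> S3q.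
Proof.
apply: (@teval_neq0 _ _ (fun g => if g is (Ga | Gas) then 1 else 0)) => t u [] /=;
  by rewrite ?(mulr0, mul0r, mulr1, scaler0, scale0r, addr0, scale1r).
Qed.

HB.instance Definition _ := GRing.PzSemiRing_isNonZero.Build S3q S3q_neq0.
HB.instance Definition _ := GRing.LSemiModule_isLSemiAlgebra.Build C S3q
  (@pscaleAl C s3gen s3rel).
HB.instance Definition _ := GRing.LSemiAlgebra_isSemiAlgebra.Build C S3q
  (@pscaleAr C s3gen s3rel).

Definition Uq : Type := presented urel.
HB.instance Definition _ := GRing.PzRing.on Uq.
HB.instance Definition _ := GRing.Lmodule.on Uq.

Lemma Uq_neq0 : 1 != 0 :> Uq.
Proof.
apply: (@teval_neq0 _ _ (fun g => if g is (GK | GKi) then 1 else 0)) => t u [] /=;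
  by rewrite ?(mulr0, mul0r, mulr1, scaler0, scale0r, addr0, scale1r, scaleN1r,
               mulN1r, subrr).
Qed.

HB.instance Definition _ := GRing.PzSemiRing_isNonZero.Build Uq Uq_neq0.
HB.instance Definition _ := GRing.LSemiModule_isLSemiAlgebra.Build C Uq
  (@pscaleAl C ugen urel).
HB.instance Definition _ := GRing.LSemiAlgebra_isSemiAlgebra.Build C Uq
  (@pscaleAr C ugen urel).

Definition s3cls (t : pterm C s3gen) : S3q := pclass s3rel t.
Definition ucls (t : pterm C ugen) : Uq := pclass urel t.

Definition gen_a : S3q := s3cls (Gen Ga).
Definition gen_as : S3q := s3cls (Gen Gas).
Definition gen_c : S3q := s3cls (Gen Gc).
Definition gen_cs : S3q := s3cls (Gen Gcs).

Definition gen_E : Uq := ucls (Gen GE).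
Definition gen_F : Uq := ucls (Gen GF).
Definition gen_K : Uq := ucls (Gen GK).
Definition gen_Ki : Uq := ucls (Gen GKi).

Local Notation a := gen_a.
Local Notation a' := gen_as.
Local Notation c := gen_c.
Local Notation c' := gen_cs.

Lemma s3clsP t u : s3cls t = s3cls u <-> cong s3rel t u.
Proof. exact: pclassP. Qed.

Lemma s3cls_rel t u : s3rel t u -> s3cls t = s3cls u.
Proof. by move=> tu; apply/s3clsP/cong_rel. Qed.

Lemma S3qW (P : S3q -> Prop) : (forall t, P (s3cls t)) -> forall x, P x.
Proof. exact: presentedW. Qed.

Lemma uclsP t u : ucls t = ucls u <-> cong urel t u.
Proof. exact: pclassP. Qed.

Lemma ucls_rel t u : urel t u -> ucls t = ucls u.
Proof. by move=> tu; apply/uclsP/cong_rel. Qed.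

Lemma UqW (P : Uq -> Prop) : (forall t, P (ucls t)) -> forall x, P x.
Proof. exact: presentedW. Qed.

Lemma s3constE k : s3cls (Const k) = k%:A.
Proof. by rewrite [RHS]pscaleE [RHS]mulr1. Qed.

Lemma s3mulE t u : s3cls (t * u)%PT = s3cls t * s3cls u.
Proof. exact: pclassM. Qed.

Lemma s3addE t u : s3cls (t + u)%PT = s3cls t + s3cls u.
Proof. exact: pclass_add. Qed.

Lemma s3scaleE k t : s3cls (k *: t)%PT = k *: s3cls t.
Proof. exact: pclassZ. Qed.

Lemma uconstE k : ucls (Const k) = k%:A.
Proof. by rewrite [RHS]pscaleE [RHS]mulr1. Qed.

Lemma umulE t u : ucls (t * u)%PT = ucls t * ucls u.
Proof. exact: pclassM. Qed.

Lemma uaddE t u : ucls (t + u)%PT = ucls t + ucls u.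
Proof. exact: pclass_add. Qed.

Lemma uscaleE k t : ucls (k *: t)%PT = k *: ucls t.
Proof. exact: pclassZ. Qed.

Lemma mul_ac : a * c = q' *: (c * a).
Proof. by rewrite /gen_a /gen_c -!s3mulE -s3scaleE; apply: s3cls_rel; constructor. Qed.

Lemma mul_csas : c' * a' = q' *: (a' * c').
Proof. by rewrite /gen_as /gen_cs -!s3mulE -s3scaleE; apply: s3cls_rel; constructor. Qed.

Lemma mul_acs : a * c' = q' *: (c' * a).
Proof. by rewrite /gen_a /gen_cs -!s3mulE -s3scaleE; apply: s3cls_rel; constructor. Qed.

Lemma mul_cas : c * a' = q' *: (a' * c).
Proof. by rewrite /gen_as /gen_c -!s3mulE -s3scaleE; apply: s3cls_rel; constructor. Qed.

Lemma mul_ccs : c * c' = c' * c.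
Proof. by rewrite /gen_cs /gen_c -!s3mulE; apply: s3cls_rel; constructor. Qed.

Lemma mul_asa : a' * a = 1 - c' * c.
Proof.
apply/eqP; rewrite eq_sym subr_eq eq_sym; apply/eqP.
rewrite /gen_a /gen_as /gen_cs /gen_c -!s3mulE -s3addE.
by apply: s3cls_rel; constructor.
Qed.

Lemma mul_aas : a * a' = 1 - q' ^+ 2 *: (c' * c).
Proof.
apply/eqP; rewrite eq_sym subr_eq eq_sym; apply/eqP; rewrite -mul_ccs.
rewrite /gen_a /gen_as /gen_cs /gen_c -!s3mulE -s3scaleE -s3addE.
by apply: s3cls_rel; constructor.
Qed.

(* The involution: antilinear, antimultiplicative, exchanging a with a^* and  *)
(* c with c^*.                                                                *)
Fixpoint star_term (t : pterm C s3gen) : pterm C s3gen :=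
  match t with
  | Const k => Const k^*
  | Gen Ga => Gen Gas
  | Gen Gas => Gen Ga
  | Gen Gc => Gen Gcs
  | Gen Gcs => Gen Gc
  | Add t u => Add (star_term t) (star_term u)
  | Mul t u => Mul (star_term u) (star_term t)
  end.

Definition star (x : S3q) : S3q := s3cls (star_term (repr x)).

Lemma star_term_cong t u :
  cong s3rel t u -> s3cls (star_term t) = s3cls (star_term u).
Proof.
elim=> {t u}.
- move=> t u [] /=; rewrite ?(s3mulE, s3addE, s3constE) //= -/a -/a' -/c -/c';
    rewrite ?rmorphXn /= ?conj_qC ?rmorph1 -?scalerAr ?mulr1.
  + exact: mul_csas.
  + exact: mul_ac.
  + exact: mul_cas.
  + exact: mul_acs.
  + by rewrite mul_ccs.
  + by rewrite mul_asa subrK scale1r.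
  + by rewrite mul_aas mul_ccs subrK scale1r.
- by [].
- by move=> t u _ ->.
- by move=> t u v _ -> _ ->.
- by move=> t t' u u' _ IHt _ IHu; rewrite /= !s3addE IHt IHu.
- by move=> t t' u u' _ IHt _ IHu; rewrite /= !s3mulE IHt IHu.
- by move=> t u v; rewrite /= !s3addE addrA.
- by move=> t u; rewrite /= !s3addE addrC.
- by move=> t; rewrite /= !(s3addE, s3constE) rmorph0 scale0r add0r.
- move=> t; rewrite /= !(s3addE, s3mulE, s3constE) rmorphN rmorph1 rmorph0.
  by rewrite scaleN1r mulrN1 addNr scale0r.
- by move=> t u v; rewrite /= !s3mulE mulrA.
- by move=> t; rewrite /= !(s3mulE, s3constE) rmorph1 scale1r mulr1.
- by move=> t; rewrite /= !(s3mulE, s3constE) rmorph1 scale1r mul1r.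
- by move=> t u v; rewrite /= !(s3mulE, s3addE) mulrDr.
- by move=> t u v; rewrite /= !(s3mulE, s3addE) mulrDl.
- by move=> k l; rewrite /= s3addE !s3constE rmorphD scalerDl.
- move=> k l; rewrite /= s3mulE !s3constE rmorphM -scalerAl mul1r scalerA.
  by rewrite mulrC.
- by move=> k t; rewrite /= !s3mulE !s3constE -scalerAl -scalerAr mul1r mulr1.
Qed.

Lemma star_pclass t : star (s3cls t) = s3cls (star_term t).
Proof. by apply: star_term_cong; apply: repr_cong. Qed.

Lemma starD : {morph star : x y / x + y}.
Proof.
elim/S3qW=> t; elim/S3qW=> u.
by rewrite -[_ + _]s3addE !star_pclass s3addE.
Qed.

Lemma starM (x y : S3q) : star (x * y) = star y * star x.
Proof.
elim/S3qW: x => t; elim/S3qW: y => u.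
by rewrite -s3mulE !star_pclass s3mulE.
Qed.

Lemma starZ (k : C) (x : S3q) : star (k *: x) = k^* *: star x.
Proof.
elim/S3qW: x => t; rewrite -s3scaleE !star_pclass /= s3mulE s3constE.
by rewrite -scalerAr mulr1.
Qed.

Lemma star1 : star 1 = 1.
Proof. by rewrite -(scale1r 1) -s3constE star_pclass /= rmorph1. Qed.

Lemma starK : involutive star.
Proof.
elim/S3qW=> t; rewrite !star_pclass; congr s3cls.
by elim: t => [k|[]|t IHt u IHu|t IHt u IHu] //=; rewrite ?conjCK ?IHt ?IHu.
Qed.

Lemma star_a : star a = a'. Proof. exact: star_pclass. Qed.
Lemma star_as : star a' = a. Proof. exact: star_pclass. Qed.
Lemma star_c : star c = c'. Proof. exact: star_pclass. Qed.
Lemma star_cs : star c' = c. Proof. exact: star_pclass. Qed.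

(* The left action of U_q(su(2)) on S^3_q. By the coproduct, K and K^-1 act   *)
(* as algebra morphisms, while E(fg) = E(f) K(g) + K^-1(f) E(g) and           *)
(* E(1) = eps(E) 1 = 0, and likewise for F.                                   *)
Definition K_gen (g : s3gen) : S3q :=
  match g with
  | Ga => s^-1 *: a | Gc => s^-1 *: c | Gas => s *: a' | Gcs => s *: c'
  end.

Definition Ki_gen (g : s3gen) : S3q :=
  match g with
  | Ga => s *: a | Gc => s *: c | Gas => s^-1 *: a' | Gcs => s^-1 *: c'
  end.

Definition E_gen (g : s3gen) : S3q :=
  match g with
  | Ga => - q' *: c' | Gc => a' | Gas => 0 | Gcs => 0
  end.

Definition F_gen (g : s3gen) : S3q :=
  match g with
  | Ga => 0 | Gc => 0 | Gas => c | Gcs => - q'^-1 *: a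
  end.

Definition K_op : S3q -> S3q := plift K_gen (rel := s3rel).
Definition Ki_op : S3q -> S3q := plift Ki_gen (rel := s3rel).

Fixpoint tder (d : s3gen -> S3q) (t : pterm C s3gen) : S3q :=
  match t with
  | Const _ => 0
  | Gen g => d g
  | Add t u => tder d t + tder d u
  | Mul t u => tder d t * K_op (s3cls u) + Ki_op (s3cls t) * tder d u
  end.

Definition E_op (f : S3q) : S3q := tder E_gen (repr f).
Definition F_op (f : S3q) : S3q := tder F_gen (repr f).

Fixpoint act_term (t : pterm C ugen) (f : S3q) : S3q :=
  match t with
  | Const k => k *: f
  | Gen GE => E_op f
  | Gen GF => F_op f
  | Gen GK => K_op f
  | Gen GKi => Ki_op f
  | Add t u => act_term t f + act_term u f
  | Mul t u => act_term t (act_term u f)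
  end.

Definition act (x : Uq) (f : S3q) : S3q := act_term (repr x) f.

Lemma K_gen_rel t u : s3rel t u -> teval K_gen t = teval K_gen u.
Proof.
have := sqrtqC_neq0 q.
move=> s0 [] /=; rewrite -?(scalerAl, scalerAr) ?scalerA ?mul1r ?mulr1.
- by rewrite mul_ac ?scalerA; congr (_ *: _); field.
- by rewrite mul_csas ?scalerA; congr (_ *: _); field.
- by rewrite mul_acs ?scalerA; congr (_ *: _); field.
- by rewrite mul_cas ?scalerA; congr (_ *: _); field.
- by rewrite mul_ccs ?scalerA; congr (_ *: _); field.
- by rewrite ?(mulfV s0, mulVf s0) !scale1r mul_asa subrK.
- by rewrite ?(mulfV s0, mulVf s0) mulr1 !scale1r mul_aas mul_ccs subrK.
Qed.

Lemma Ki_gen_rel t u : s3rel t u -> teval Ki_gen t = teval Ki_gen u.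
Proof.
have := sqrtqC_neq0 q.
move=> s0 [] /=; rewrite -?(scalerAl, scalerAr) ?scalerA ?mul1r ?mulr1.
- by rewrite mul_ac ?scalerA; congr (_ *: _); field.
- by rewrite mul_csas ?scalerA; congr (_ *: _); field.
- by rewrite mul_acs ?scalerA; congr (_ *: _); field.
- by rewrite mul_cas ?scalerA; congr (_ *: _); field.
- by rewrite mul_ccs ?scalerA; congr (_ *: _); field.
- by rewrite ?(mulfV s0, mulVf s0) !scale1r mul_asa subrK.
- by rewrite ?(mulfV s0, mulVf s0) mulr1 !scale1r mul_aas mul_ccs subrK.
Qed.

Lemma K_pclass t : K_op (s3cls t) = teval K_gen t.
Proof. exact: (pliftP K_gen_rel). Qed.

Lemma Ki_pclass t : Ki_op (s3cls t) = teval Ki_gen t.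
Proof. exact: (pliftP Ki_gen_rel). Qed.

Lemma K_opD : {morph K_op : x y / x + y}.
Proof.
elim/S3qW=> t; elim/S3qW=> u.
by rewrite -[_ + _]s3addE !K_pclass.
Qed.

Lemma K_opM : {morph K_op : x y / x * y}.
Proof.
elim/S3qW=> t; elim/S3qW=> u.
by rewrite -[_ * _]s3mulE !K_pclass.
Qed.

Lemma K_opZ k : {morph K_op : x / k *: x}.
Proof.
elim/S3qW=> t; rewrite -[_ *: _]s3scaleE !K_pclass /=.
by rewrite -scalerAl mul1r.
Qed.

Lemma Ki_opD : {morph Ki_op : x y / x + y}.
Proof.
elim/S3qW=> t; elim/S3qW=> u.
by rewrite -[_ + _]s3addE !Ki_pclass.
Qed.

Lemma Ki_opM : {morph Ki_op : x y / x * y}.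
Proof.
elim/S3qW=> t; elim/S3qW=> u.
by rewrite -[_ * _]s3mulE !Ki_pclass.
Qed.

Lemma Ki_opZ k : {morph Ki_op : x / k *: x}.
Proof.
elim/S3qW=> t; rewrite -[_ *: _]s3scaleE !Ki_pclass /=.
by rewrite -scalerAl mul1r.
Qed.

Lemma K_op1 : K_op 1 = 1.
Proof. by have := K_pclass (Const 1); rewrite s3constE /= scale1r. Qed.

Lemma Ki_op1 : Ki_op 1 = 1.
Proof. by have := Ki_pclass (Const 1); rewrite s3constE /= scale1r. Qed.

Lemma K_gensE : (K_op a = s^-1 *: a) * (K_op c = s^-1 *: c) *
  (K_op a' = s *: a') * (K_op c' = s *: c').
Proof. by rewrite !K_pclass. Qed.

Lemma Ki_gensE : (Ki_op a = s *: a) * (Ki_op c = s *: c) *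
  (Ki_op a' = s^-1 *: a') * (Ki_op c' = s^-1 *: c').
Proof. by rewrite !Ki_pclass. Qed.

Lemma tder_cong (d : s3gen -> S3q) :
  (forall t u, s3rel t u -> tder d t = tder d u) ->
  forall t u, cong s3rel t u -> tder d t = tder d u.
Proof.
move=> drel t u; elim=> {t u} //=.
- by move=> t u v _ -> _ ->.
- by move=> t t' u u' _ -> _ ->.
- move=> t t' u u' tt' -> uu' ->.
  by move/s3clsP: tt' => ->; move/s3clsP: uu' => ->.
- by move=> *; rewrite addrA.
- by move=> *; rewrite addrC.
- by move=> *; rewrite add0r.
- move=> t; rewrite mul0r add0r s3constE Ki_opZ Ki_op1 scaleN1r mulN1r.
  by rewrite addNr.
- move=> t u v; rewrite !s3mulE K_opM Ki_opM mulrDl mulrDr !mulrA addrA.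
  by [].
- by move=> t; rewrite mul0r add0r s3constE Ki_opZ Ki_op1 scale1r mul1r.
- by move=> t; rewrite mulr0 addr0 s3constE K_opZ K_op1 scale1r mulr1.
- by move=> t u v; rewrite s3addE Ki_opD !mulrDl addrACA.
- by move=> t u v; rewrite s3addE K_opD !mulrDr addrACA.
- by move=> *; rewrite addr0.
- by move=> *; rewrite mul0r mulr0 addr0.
- move=> k t; rewrite mul0r mulr0 add0r addr0 s3constE Ki_opZ K_opZ Ki_op1 K_op1.
  by rewrite -scalerAl -scalerAr mul1r mulr1.
Qed.

Lemma E_gen_rel t u : s3rel t u -> tder E_gen t = tder E_gen u.
Proof.
have s0 := sqrtqC_neq0 q; have qs := sqrtqC2 q.
move=> [] /=; rewrite -/a -/a' -/c -/c' ?s3constE ?Ki_opZ ?Ki_op1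
  ?K_gensE ?Ki_gensE -?(scalerAl, scalerAr)
  ?mul0r ?mulr0 ?mul1r ?add0r ?addr0 ?scaler0 //.
- rewrite mul_aas mul_asa mul_ccs !(scalerBr, scalerDr, scalerA) addrCA.
  rewrite -addrA -scalerBl -scaleNr -scalerDl.
  by congr (_ *: _ + _ *: _); rewrite -qs; field.
- by rewrite addr0 scaler0.
- by rewrite add0r addr0 ?scalerA; congr (_ *: _); rewrite -qs; field.
- by rewrite add0r addr0 ?scalerA; congr (_ *: _); rewrite -qs; field.
- by rewrite add0r addr0 mul_csas ?scalerA; congr (_ *: _); rewrite -qs; field.
- rewrite mul_csas !add0r !scalerA -scalerDl [X in X *: _](_ : _ = 0) ?scale0r //.
  by rewrite -qs; field.
- rewrite mul_csas !addr0 !scalerA -scalerDl [X in X *: _](_ : _ = 0) ?scale0r //.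
  by rewrite -qs; field.
Qed.

Lemma F_gen_rel t u : s3rel t u -> tder F_gen t = tder F_gen u.
Proof.
have s0 := sqrtqC_neq0 q; have qs := sqrtqC2 q.
move=> [] /=; rewrite -/a -/a' -/c -/c' ?s3constE ?Ki_opZ ?Ki_op1
  ?K_gensE ?Ki_gensE -?(scalerAl, scalerAr)
  ?mul0r ?mulr0 ?mul1r ?add0r ?addr0 ?scaler0 //.
- by rewrite addr0 scaler0.
- rewrite mul_aas mul_asa mul_ccs !(scalerBr, scalerDr, scalerA).
  rewrite -addrA -scaleNr -scalerDl [RHS]addrCA -scaleNr -scalerDl.
  by congr (_ *: _ + _ *: _); rewrite -qs; field.
- by rewrite add0r addr0 ?scalerA; congr (_ *: _); rewrite -qs; field.
- by rewrite add0r addr0 ?scalerA; congr (_ *: _); rewrite -qs; field.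
- by rewrite add0r addr0 mul_ac ?scalerA; congr (_ *: _); rewrite -qs; field.
- rewrite mul_ac !addr0 !scalerA -scalerDl [X in X *: _](_ : _ = 0) ?scale0r //.
  by rewrite -qs; field.
- rewrite mul_ac !add0r !scalerA -scalerDl [X in X *: _](_ : _ = 0) ?scale0r //.
  by rewrite -qs; field.
Qed.

Lemma E_s3cls t : E_op (s3cls t) = tder E_gen t.
Proof. by apply: (tder_cong E_gen_rel); apply: repr_cong. Qed.

Lemma F_s3cls t : F_op (s3cls t) = tder F_gen t.
Proof. by apply: (tder_cong F_gen_rel); apply: repr_cong. Qed.

Lemma E_opD : {morph E_op : x y / x + y}.
Proof. by elim/S3qW=> t; elim/S3qW=> u; rewrite -s3addE !E_s3cls. Qed.

Lemma F_opD : {morph F_op : x y / x + y}.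
Proof. by elim/S3qW=> t; elim/S3qW=> u; rewrite -s3addE !F_s3cls. Qed.

Lemma E_opM x y : E_op (x * y) = E_op x * K_op y + Ki_op x * E_op y.
Proof. by elim/S3qW: x => t; elim/S3qW: y => u; rewrite -s3mulE !E_s3cls. Qed.

Lemma F_opM x y : F_op (x * y) = F_op x * K_op y + Ki_op x * F_op y.
Proof. by elim/S3qW: x => t; elim/S3qW: y => u; rewrite -s3mulE !F_s3cls. Qed.

Lemma E_opZ k : {morph E_op : x / k *: x}.
Proof.
elim/S3qW=> t; rewrite -s3scaleE !E_s3cls /= mul0r add0r s3constE.
by rewrite Ki_opZ Ki_op1 -scalerAl mul1r.
Qed.

Lemma F_opZ k : {morph F_op : x / k *: x}.
Proof.
elim/S3qW=> t; rewrite -s3scaleE !F_s3cls /= mul0r add0r s3constE.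
by rewrite Ki_opZ Ki_op1 -scalerAl mul1r.
Qed.

Lemma E_op1 : E_op 1 = 0.
Proof. by have := E_s3cls (Const 1); rewrite s3constE /= scale1r. Qed.

Lemma F_op1 : F_op 1 = 0.
Proof. by have := F_s3cls (Const 1); rewrite s3constE /= scale1r. Qed.

Lemma E_gensE : (E_op a = - q' *: c') * (E_op c = a') *
  (E_op a' = 0) * (E_op c' = 0).
Proof. by rewrite /gen_a /gen_as /gen_c /gen_cs !E_s3cls. Qed.

Lemma F_gensE : (F_op a = 0) * (F_op c = 0) *
  (F_op a' = c) * (F_op c' = - q'^-1 *: a).
Proof. by rewrite /gen_a /gen_as /gen_c /gen_cs !F_s3cls. Qed.

Lemma S3q_ind (P : S3q -> Prop) :
  (forall k, P k%:A) -> P a -> P a' -> P c -> P c' ->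
  (forall x y, P x -> P y -> P (x + y)) ->
  (forall x y, P x -> P y -> P (x * y)) -> forall x, P x.
Proof.
move=> Pk Pa Pa' Pc Pc' PD PM; elim/S3qW.
elim=> [k|[]|t Pt u Pu|t Pt u Pu] //.
- by rewrite s3constE.
- by rewrite s3addE; apply: PD.
- by rewrite s3mulE; apply: PM.
Qed.

Lemma K_opK : cancel K_op Ki_op.
Proof.
have s0 := sqrtqC_neq0 q.
elim/S3q_ind => [k|||||x y IHx IHy|x y IHx IHy].
- by rewrite K_opZ Ki_opZ K_op1 Ki_op1.
- by rewrite K_gensE Ki_opZ Ki_gensE scalerA mulVf ?scale1r.
- by rewrite K_gensE Ki_opZ Ki_gensE scalerA mulfV ?scale1r.
- by rewrite K_gensE Ki_opZ Ki_gensE scalerA mulVf ?scale1r.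
- by rewrite K_gensE Ki_opZ Ki_gensE scalerA mulfV ?scale1r.
- by rewrite K_opD Ki_opD IHx IHy.
- by rewrite K_opM Ki_opM IHx IHy.
Qed.

Lemma Ki_opK : cancel Ki_op K_op.
Proof.
have s0 := sqrtqC_neq0 q.
elim/S3q_ind => [k|||||x y IHx IHy|x y IHx IHy].
- by rewrite Ki_opZ K_opZ Ki_op1 K_op1.
- by rewrite Ki_gensE K_opZ K_gensE scalerA mulfV ?scale1r.
- by rewrite Ki_gensE K_opZ K_gensE scalerA mulVf ?scale1r.
- by rewrite Ki_gensE K_opZ K_gensE scalerA mulfV ?scale1r.
- by rewrite Ki_gensE K_opZ K_gensE scalerA mulVf ?scale1r.
- by rewrite Ki_opD K_opD IHx IHy.
- by rewrite Ki_opM K_opM IHx IHy.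
Qed.

Lemma scale0_op (f : S3q -> S3q) : (forall k, {morph f : x / k *: x}) -> f 0 = 0.
Proof. by move=> fZ; have := fZ 0 0; rewrite !scale0r. Qed.

Let E0 := scale0_op E_opZ.
Let F0 := scale0_op F_opZ.
Let K0 := scale0_op K_opZ.
Let Ki0 := scale0_op Ki_opZ.

Lemma KE_op x : K_op (E_op x) = q' *: E_op (K_op x).
Proof.
have s0 := sqrtqC_neq0 q; have qs := sqrtqC2 q.
elim/S3q_ind: x => [k|||||x y IHx IHy|x y IHx IHy].
- by rewrite !(E_opZ, K_opZ) E_op1 K_op1 E_op1 K0 !scaler0.
- rewrite K_gensE E_gensE !(E_opZ, K_opZ) K_gensE E_gensE !scalerA.
  by congr (_ *: _); rewrite -qs; field.
- by rewrite K_gensE E_gensE !(E_opZ, K_opZ) E_gensE K0 !scaler0.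
- rewrite K_gensE E_gensE !(E_opZ, K_opZ) K_gensE E_gensE !scalerA.
  by congr (_ *: _); rewrite -qs; field.
- by rewrite K_gensE E_gensE !(E_opZ, K_opZ) E_gensE K0 !scaler0.
- by rewrite E_opD !K_opD E_opD IHx IHy scalerDr.
- rewrite E_opM K_opD !K_opM E_opM IHx IHy K_opK Ki_opK scalerDr.
  by rewrite -scalerAl -scalerAr.
Qed.

Lemma KF_op x : K_op (F_op x) = q'^-1 *: F_op (K_op x).
Proof.
have s0 := sqrtqC_neq0 q; have qs := sqrtqC2 q.
elim/S3q_ind: x => [k|||||x y IHx IHy|x y IHx IHy].
- by rewrite !(F_opZ, K_opZ) F_op1 K_op1 F_op1 K0 !scaler0.
- by rewrite K_gensE F_gensE !(F_opZ, K_opZ) F_gensE K0 !scaler0.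
- rewrite K_gensE F_gensE !(F_opZ, K_opZ) K_gensE F_gensE !scalerA.
  by congr (_ *: _); rewrite -qs; field.
- by rewrite K_gensE F_gensE !(F_opZ, K_opZ) F_gensE K0 !scaler0.
- rewrite K_gensE F_gensE !(F_opZ, K_opZ) K_gensE F_gensE !scalerA.
  by congr (_ *: _); rewrite -qs; field.
- by rewrite F_opD !K_opD F_opD IHx IHy scalerDr.
- rewrite F_opM K_opD !K_opM F_opM IHx IHy K_opK Ki_opK scalerDr.
  by rewrite -scalerAl -scalerAr.
Qed.

Lemma KiE_op x : Ki_op (E_op x) = q'^-1 *: E_op (Ki_op x).
Proof.
rewrite -{1}[x]Ki_opK -[E_op (K_op _)](scale1r) -(mulVf (qC_neq0 q)).
by rewrite -scalerA -KE_op Ki_opZ K_opK.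
Qed.

Lemma KiF_op x : Ki_op (F_op x) = q' *: F_op (Ki_op x).
Proof.
rewrite -{1}[x]Ki_opK -[F_op (K_op _)](scale1r) -(mulfV (qC_neq0 q)).
by rewrite -scalerA -KF_op Ki_opZ K_opK.
Qed.

Lemma zmod_cross (V : zmodType) (x1 x2 y1 y2 u v : V) :
  x1 + u + (v + y1) - (x2 + v + (u + y2)) = x1 - x2 + (y1 - y2).
Proof.
rewrite [v + y1]addrC [x1 + u + _]addrACA [u + y2]addrC [x2 + v + _]addrACA.
by rewrite [v + u]addrC [- (x2 + y2 + _)]opprD [LHS]addrACA subrr addr0 opprD addrACA.
Qed.

Lemma EF_op x : E_op (F_op x) + (- 1) *: F_op (E_op x) =
  (q' - q'^-1)^-1 *: (K_op (K_op x) + (- 1) *: Ki_op (Ki_op x)).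
Proof.
have s0 := sqrtqC_neq0 q; have qs := sqrtqC2 q.
have q0 := qC_neq0 q; have q1 := qC2_neq1 q.
have d0 : s * s * (s * s) - 1 != 0 by rewrite subr_eq0 qs -expr2.
elim/S3q_ind: x => [k|||||x y IHx IHy|x y IHx IHy].
- rewrite !(F_opZ, E_opZ, K_opZ, Ki_opZ) E_op1 F_op1 E0 F0 !(K_op1, Ki_op1).
  by rewrite !scaler0 addr0 scaleN1r subrr scaler0.
- rewrite !(F_gensE, E_gensE, K_gensE, Ki_gensE, F_opZ, E_opZ, K_opZ, Ki_opZ).
  rewrite !E0 add0r !scalerA -scalerDl scalerA.
  by congr (_ *: _); rewrite -qs; field; apply/andP; split; [exact: s0|exact: d0].
- rewrite !(F_gensE, E_gensE, K_gensE, Ki_gensE, F_opZ, E_opZ, K_opZ, Ki_opZ).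
  rewrite !F0 scaler0 addr0 !scalerA -scalerDl scalerA -[LHS]scale1r.
  by congr (_ *: _); rewrite -qs; field; apply/andP; split; [exact: s0|exact: d0].
- rewrite !(F_gensE, E_gensE, K_gensE, Ki_gensE, F_opZ, E_opZ, K_opZ, Ki_opZ).
  rewrite !E0 add0r !scalerA -scalerDl scalerA.
  by congr (_ *: _); rewrite -qs; field; apply/andP; split; [exact: s0|exact: d0].
- rewrite !(F_gensE, E_gensE, K_gensE, Ki_gensE, F_opZ, E_opZ, K_opZ, Ki_opZ).
  rewrite !F0 scaler0 addr0 !scalerA -scalerDl scalerA.
  by congr (_ *: _); rewrite -qs; field; apply/andP; split; [exact: s0|exact: d0].
- rewrite !(F_opD, E_opD, K_opD, Ki_opD) !scalerDr addrACA IHx IHy.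
  by rewrite !scalerDr addrACA.
- rewrite !(F_opM, E_opM, F_opD, E_opD, K_opM, Ki_opM).
  rewrite KE_op KF_op KiE_op KiF_op !scaleN1r -!(scalerAl, scalerAr) zmod_cross.
  rewrite -mulrBl -mulrBr.
  have -> : E_op (F_op x) - F_op (E_op x) =
      (q' - q'^-1)^-1 *: (K_op (K_op x) - Ki_op (Ki_op x)).
    by move: IHx; rewrite !scaleN1r.
  have -> : E_op (F_op y) - F_op (E_op y) =
      (q' - q'^-1)^-1 *: (K_op (K_op y) - Ki_op (Ki_op y)).
    by move: IHy; rewrite !scaleN1r.
  rewrite -scalerAl -scalerAr -scalerDr mulrBl mulrBr.
  by rewrite addrA subrK.
Qed.

Lemma act_termD t : {morph act_term t : x y / x + y}.
Proof.
elim: t => [k|[]|t IHt u IHu|t IHt u IHu] x y /=.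
- by rewrite scalerDr.
- exact: E_opD.
- exact: F_opD.
- exact: K_opD.
- exact: Ki_opD.
- by rewrite IHt IHu addrACA.
- by rewrite IHu IHt.
Qed.

Lemma act_termZ t k : {morph act_term t : x / k *: x}.
Proof.
elim: t => [l|[]|t IHt u IHu|t IHt u IHu] x /=.
- by rewrite !scalerA mulrC.
- exact: E_opZ.
- exact: F_opZ.
- exact: K_opZ.
- exact: Ki_opZ.
- by rewrite IHt IHu scalerDr.
- by rewrite IHu IHt.
Qed.

Lemma act_term_cong t u : cong urel t u -> act_term t =1 act_term u.
Proof.
elim=> {t u} //=.
- move=> t u [] f /=.
  + by rewrite Ki_opK scale1r.
  + by rewrite K_opK scale1r.
  + exact: KE_op.
  + exact: KiE_op.
  + exact: KF_op.
  + exact: KiF_op.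
  + exact: EF_op.
- by move=> t u _ IH f; rewrite IH.
- by move=> t u v _ IH _ IH' f; rewrite IH IH'.
- by move=> t t' u u' _ IH _ IH' f; rewrite IH IH'.
- by move=> t t' u u' _ IH _ IH' f; rewrite IH' IH.
- by move=> t u v f; rewrite addrA.
- by move=> t u f; rewrite addrC.
- by move=> t f; rewrite scale0r add0r.
- by move=> t f; rewrite scaleN1r addNr scale0r.
- by move=> t f; rewrite scale1r.
- by move=> t f; rewrite scale1r.
- by move=> t u v f; rewrite act_termD.
- by move=> k l f; rewrite scalerDl.
- by move=> k l f; rewrite scalerA.
- by move=> k t f; rewrite act_termZ.
Qed.

Lemma act_ucls t f : act (ucls t) f = act_term t f.
Proof. by apply: act_term_cong; apply: repr_cong. Qed.

Lemma act_E f : act gen_E f = E_op f. Proof. exact: act_ucls. Qed.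
Lemma act_F f : act gen_F f = F_op f. Proof. exact: act_ucls. Qed.
Lemma act_K f : act gen_K f = K_op f. Proof. exact: act_ucls. Qed.
Lemma act_Ki f : act gen_Ki f = Ki_op f. Proof. exact: act_ucls. Qed.

Lemma actM x y f : act (x * y) f = act x (act y f).
Proof. by elim/UqW: x => t; elim/UqW: y => u; rewrite -umulE !act_ucls. Qed.

Lemma actDl x y f : act (x + y) f = act x f + act y f.
Proof. by elim/UqW: x => t; elim/UqW: y => u; rewrite -uaddE !act_ucls. Qed.

Lemma actZl k x f : act (k *: x) f = k *: act x f.
Proof. by elim/UqW: x => t; rewrite -uscaleE !act_ucls. Qed.

Lemma act1 f : act 1 f = f.
Proof. by have := act_ucls (Const 1) f; rewrite uconstE /= !scale1r. Qed.

Lemma actDr x : {morph act x : f g / f + g}.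
Proof. exact: act_termD. Qed.

Lemma actZr x k : {morph act x : f / k *: f}.
Proof. exact: act_termZ. Qed.

(* S^3_q is a left U_q(su(2))-module algebra. *)
Lemma act_KM f g : act gen_K (f * g) = act gen_K f * act gen_K g.
Proof. by rewrite !act_K K_opM. Qed.

Lemma act_KiM f g : act gen_Ki (f * g) = act gen_Ki f * act gen_Ki g.
Proof. by rewrite !act_Ki Ki_opM. Qed.

Lemma act_EM f g :
  act gen_E (f * g) = act gen_E f * act gen_K g + act gen_Ki f * act gen_E g.
Proof. by rewrite !act_E act_K act_Ki E_opM. Qed.

Lemma act_FM f g :
  act gen_F (f * g) = act gen_F f * act gen_K g + act gen_Ki f * act gen_F g.
Proof. by rewrite !act_F act_K act_Ki F_opM. Qed.

End QuantumAlgebras.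

Notation "x |> f" := (act x f) (at level 40, no associativity) : ring_scope.

(* The indices +, -, z. *)
Inductive dir := Plus | Minus | Zed.

Definition dir_code (d : dir) : option bool :=
  match d with Plus => Some true | Minus => Some false | Zed => None end.
Definition dir_decode (b : option bool) : dir :=
  match b with Some true => Plus | Some false => Minus | None => Zed end.
Lemma dir_codeK : cancel dir_code dir_decode. Proof. by case. Qed.
HB.instance Definition _ := Finite.copy dir (can_type dir_codeK).

Lemma sum_dir (V : nmodType) (F : dir -> V) :
  \sum_d F d = F Plus + F Minus + F Zed.
Proof.
rewrite (bigD1 Plus) // (bigD1 Minus) // (bigD1 Zed) //= big1 ?addr0 ?addrA //.
by case.
Qed.

Section TangentSpace.
Context (R : realType) (q : qparam R).
Local Notation C := R[i].
Local Notation E := (gen_E q).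
Local Notation F := (gen_F q).
Local Notation K := (gen_K q).

Definition X (d : dir) : Uq q :=
  match d with
  | Plus => sqrtqC q *: (E * K)
  | Minus => (sqrtqC q)^-1 *: (F * K)
  | Zed => (1 - qC q ^- 2)^-1 *: (1 - K ^+ 4)
  end.

Definition sigma (d : dir) : Uq q :=
  match d with Plus | Minus => K ^+ 2 | Zed => K ^+ 4 end.

(* The quantum tangent space: the complex span of X_+, X_-, X_z in            *)
(* U_q(su(2)).                                                                *)
Definition in_TS : {pred Uq q} :=
  fun x => `[< exists k : dir -> C, x = \sum_d k d *: X d >].

Lemma in_TS_submod : submod_closed in_TS.
Proof.
split=> [|k x y /asboolP[kx ->] /asboolP[ky ->]]; apply/asboolP.
  by exists (fun=> 0); rewrite big1 // => d _; rewrite scale0r.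
exists (fun d => k * kx d + ky d).
rewrite scaler_sumr -big_split /=; apply: eq_bigr => d _.
by rewrite scalerDl scalerA.
Qed.

HB.instance Definition _ := GRing.isSubmodClosed.Build C (Uq q) in_TS in_TS_submod.

Record TS : Type := MkTS { TSval : Uq q; TSvalP : in_TS TSval }.
HB.instance Definition _ := [isSub for TSval].
HB.instance Definition _ := [Choice of TS by <:].
HB.instance Definition _ := [SubChoice_isSubLmodule of TS by <:].

Lemma X_in_TS d : in_TS (X d).
Proof.
apply/asboolP; exists (fun e => (e == d)%:R).
rewrite (bigD1 d) //= eqxx scale1r big1 ?addr0 // => e /negPf->.
by rewrite scale0r.
Qed.

Definition TX (d : dir) : TS := MkTS (X_in_TS d).

Lemma act_sigma1 d : sigma d |> 1 = 1.
Proof.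
have K1 : K |> 1 = 1 by rewrite act_K K_op1.
by case: d; rewrite /sigma !exprS expr0 !actM act1 !K1.
Qed.

Lemma act_sigmaM d f g : sigma d |> (f * g) = (sigma d |> f) * (sigma d |> g).
Proof.
by case: d; rewrite /sigma !exprS expr0 !actM !act1 !act_KM.
Qed.

Lemma act_XM d f g :
  X d |> (f * g) = f * (X d |> g) + (X d |> f) * (sigma d |> g).
Proof.
have key h k : k = gen_E q \/ k = gen_F q ->
    h *: (k * K) |> (f * g) =
    f * (h *: (k * K) |> g) + (h *: (k * K) |> f) * (K ^+ 2 |> g).
  move=> hk; rewrite !actZl expr2 !actM act_KM -scalerAl -scalerAr -scalerDr.
  congr (_ *: _); rewrite addrC.
  by case: hk => ->; rewrite (act_EM, act_FM) !act_Ki !act_K K_opK.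
case: d; rewrite /X /sigma; try by apply: key; auto.
rewrite !actZl -scalerAl -scalerAr -scalerDr; congr (_ *: _).
have actB x h : (1 - x) |> h = h - (x |> h).
  by rewrite -scaleN1r actDl actZl act1 scaleN1r.
rewrite !actB mulrBr mulrBl addrA subrK; congr (_ - _).
exact: (act_sigmaM Zed).
Qed.

End TangentSpace.

(* A right S^3_q-module is a left module over the converse ring of S^3_q;     *)
(* complex scalars act through the unit of S^3_q.                             *)
Section RightModules.
Context (R : realType) (q : qparam R).
Local Notation C := R[i].
Local Notation A := (S3q q).

Definition rmul (M : lmodType A^c) (m : M) (f : A) : M := (f : A^c) *: m.
Definition cmul (M : lmodType A^c) (k : C) (m : M) : M := rmul m (k%:A : A).
End RightModules.

Notation "m *r f" := (rmul m f) (at level 40, left associativity) : ring_scope.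
Notation "k *c m" := (cmul k m) (at level 40, left associativity) : ring_scope.

Section Calculus.
Context (R : realType) (q : qparam R).
Local Notation C := R[i].
Local Notation A := (S3q q).

(* Omega^1(S^3_q), as a free left module: w : Omega1 stands for               *)
(* \sum_d w d omega_d. The bimodule relations read                            *)
(* omega_d f = sigma_d(f) omega_d on the generators f (lemma sigma_gens),     *)
(* whence the right module structure; the elements omega_d are recovered as   *)
(* a dc - qc da, etc., in lemmas omega_plusE, omega_minusE and omega_zedE.    *)
Definition Omega1 : Type := {ffun dir -> A}.
HB.instance Definition _ := GRing.Zmodule.on Omega1.
Identity Coercion ffun_of_Omega1 : Omega1 >-> finfun_of.

Definition omega (d : dir) : Omega1 := [ffun e => (e == d)%:R].

Definition lmulO (f : A) (w : Omega1) : Omega1 := [ffun d => f * w d].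
Definition rmulO (f : A^c) (w : Omega1) : Omega1 :=
  [ffun d => w d * (sigma q d |> f)].

Lemma rmulOA (f g : A^c) (w : Omega1) : rmulO f (rmulO g w) = rmulO (f * g) w.
Proof. by apply/ffunP => d; rewrite !ffunE -mulrA -act_sigmaM. Qed.

Lemma rmulO1 : left_id 1 rmulO.
Proof. by move=> w; apply/ffunP => d; rewrite !ffunE act_sigma1 mulr1. Qed.

Lemma rmulODr : right_distributive rmulO +%R.
Proof. by move=> f v w; apply/ffunP => d; rewrite !ffunE mulrDl. Qed.

Lemma rmulODl w : {morph rmulO^~ w : f g / f + g}.
Proof. by move=> f g; apply/ffunP => d; rewrite !ffunE actDr mulrDr. Qed.

HB.instance Definition _ :=
  GRing.Zmodule_isLmodule.Build A^c Omega1 rmulOA rmulO1 rmulODr rmulODl.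

Definition dO (f : A) : Omega1 := [ffun d => X q d |> f].

Lemma rmulOE (w : Omega1) (f : A) d : (w *r f) d = w d * (sigma q d |> f).
Proof. by rewrite ffunE. Qed.

Lemma lmul_rmul (f g : A) (w : Omega1) : lmulO f (w *r g) = lmulO f w *r g.
Proof. by apply/ffunP => d; rewrite !ffunE mulrA. Qed.

Lemma Omega1_basis (w : Omega1) : w = \sum_d lmulO (w d) (omega d).
Proof.
apply/ffunP => e; rewrite sum_ffunE (bigD1 e) //= !ffunE eqxx mulr1.
rewrite big1 ?addr0 // => d /negPf de; rewrite !ffunE eq_sym de mulr0.
by [].
Qed.

Lemma omega_rmul d f : omega d *r f = lmulO (sigma q d |> f) (omega d).
Proof.
apply/ffunP => e; rewrite rmulOE !ffunE; case: eqP => [->|_].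
  by rewrite mul1r mulr1.
by rewrite mul0r mulr0.
Qed.

Let q' := qC q.

Lemma sigma_gens d (k := if d is Zed then q' ^+ 2 else q') :
  (sigma q d |> gen_a q = k^-1 *: gen_a q) *
  (sigma q d |> gen_c q = k^-1 *: gen_c q) *
  (sigma q d |> gen_as q = k *: gen_as q) *
  (sigma q d |> gen_cs q = k *: gen_cs q).
Proof.
have s0 := sqrtqC_neq0 q; have qs := sqrtqC2 q.
rewrite {}/k /q'; case: d; rewrite /sigma !exprS expr0 !actM !act1 !act_K
  !(K_gensE, K_opZ) !scalerA; do ?[split]; congr (_ *: _); rewrite -qs; by field.
Qed.

Lemma X_gens :
  ((X q Plus |> gen_a q = - q' *: gen_cs q) * (X q Plus |> gen_c q = gen_as q) *
   (X q Plus |> gen_as q = 0) * (X q Plus |> gen_cs q = 0)) *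
  ((X q Minus |> gen_a q = 0) * (X q Minus |> gen_c q = 0) *
   (X q Minus |> gen_as q = gen_c q) *
   (X q Minus |> gen_cs q = - q'^-1 *: gen_a q)) *
  ((X q Zed |> gen_a q = gen_a q) * (X q Zed |> gen_c q = gen_c q) *
   (X q Zed |> gen_as q = - q' ^+ 2 *: gen_as q) *
   (X q Zed |> gen_cs q = - q' ^+ 2 *: gen_cs q)).
Proof.
have s0 := sqrtqC_neq0 q; have qs := sqrtqC2 q.
have d0 : sqrtqC q * sqrtqC q * (sqrtqC q * sqrtqC q) - 1 != 0.
  by rewrite subr_eq0 qs -expr2 qC2_neq1.
have K4 f : gen_K q ^+ 4 |> f = K_op (K_op (K_op (K_op f))).
  by rewrite !exprS expr0 !actM act1 !act_K.
have Xz f : X q Zed |> f = (1 - q' ^- 2)^-1 *: (f - K_op (K_op (K_op (K_op f)))).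
  by rewrite /X actZl actDl act1 -scaleN1r actZl K4 scaleN1r.
have Xp f : X q Plus |> f = sqrtqC q *: E_op (K_op f).
  by rewrite /X actZl actM act_E act_K.
have Xm f : X q Minus |> f = (sqrtqC q)^-1 *: F_op (K_op f).
  by rewrite /X actZl actM act_F act_K.
have zed (x : A) k : (1 - q' ^- 2)^-1 *: (x - k *: x) =
    ((1 - q' ^- 2)^-1 * (1 - k)) *: x.
  by rewrite -scalerA scalerBl scale1r.
rewrite !Xz !Xp !Xm !K_gensE !(E_opZ, F_opZ) !(E_gensE, F_gensE).
rewrite !(K_opZ, K_gensE) !scalerA ?scaler0 !zed /q' -qs.
have side : (sqrtqC q != 0) &&
    (sqrtqC q * sqrtqC q * (sqrtqC q * sqrtqC q) - 1 != 0) by rewrite s0 d0.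
do ?[split] => //; first [congr (_ *: _) | rewrite -[RHS]scale1r; congr (_ *: _)];
  field; by [exact: s0 | exact: side].
Qed.

Lemma omega_plusE :
  omega Plus = lmulO (gen_a q) (dO (gen_c q)) - lmulO (q' *: gen_c q) (dO (gen_a q)).
Proof.
apply/ffunP => -[]; rewrite !ffunE !X_gens /= ?mulr0 ?subr0 //.
- rewrite -scalerAl -scalerAr mul_aas mul_ccs scalerA mulrN -expr2.
  by rewrite scaleNr opprK subrK.
- by rewrite -scalerAl mul_ac subrr.
Qed.

Lemma omega_minusE :
  omega Minus =
  lmulO (gen_cs q) (dO (gen_as q)) - lmulO (q' *: gen_as q) (dO (gen_cs q)).
Proof.
have q0 := qC_neq0 q.
apply/ffunP => -[]; rewrite !ffunE !X_gens /= ?mulr0 ?subr0 //.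
- rewrite -scalerAl -scalerAr mul_asa scalerA mulrN mulfV // scaleN1r.
  by rewrite opprK addrC subrK.
- by rewrite -scalerAl -!scalerAr mul_csas scalerA scalerA mulrC subrr.
Qed.

Lemma omega_zedE :
  omega Zed = lmulO (gen_as q) (dO (gen_a q)) + lmulO (gen_cs q) (dO (gen_c q)).
Proof.
apply/ffunP => -[]; rewrite !ffunE !X_gens /= ?mulr0 ?addr0 //.
- by rewrite -scalerAr mul_csas scaleNr addNr.
- by rewrite mul_asa subrK.
Qed.

Lemma dOM (f g : A) : dO (f * g) = lmulO f (dO g) + dO f *r g.
Proof. by apply/ffunP => d; rewrite !ffunE act_XM. Qed.

End Calculus.

Section Connections.
Context (R : realType) (q : qparam R).
Local Notation C := R[i].
Local Notation A := (S3q q).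

Section Module.
Context (M : lmodType A^c).

Record hermitian_form : Type := HermitianForm {
  hform :> M -> M -> A;
  hform_rmul : forall m1 m2 f, hform m1 (m2 *r f) = hform m1 m2 * f;
  hform_star : forall m1 m2, star (hform m1 m2) = hform m2 m1;
  hformDl : forall m1 m2 m3, hform (m1 + m2) m3 = hform m1 m3 + hform m2 m3
}.

(* The dual module of M: right-linear maps to S^3_q, which is a right module  *)
(* over itself by multiplication.                                             *)
Definition dual : Type := {linear M -> (A^c)^o}.

Definition hat_fun (h : hermitian_form) (m1 : M) : M -> (A^c)^o := h m1.

Lemma hat_linear h m1 : linear (hat_fun h m1).
Proof.
move=> f m2 m3; rewrite /hat_fun -[h m1 _]hform_star hformDl starD.
by rewrite !hform_star; congr (_ + _); apply: hform_rmul.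
Qed.

HB.instance Definition _ h m1 :=
  GRing.isLinear.Build A^c M (A^c)^o *:%R (hat_fun h m1) (hat_linear h m1).

Definition hat (h : hermitian_form) (m1 : M) : dual := hat_fun h m1.

Definition invertible (h : hermitian_form) : Prop := bijective (hat h).

Definition right_affine_connection (nabla : TS q -> M -> M) : Prop :=
  [/\ forall (k : C) Y Z m, nabla (k *: Y + Z) m = k *c nabla Y m + nabla Z m,
      forall Y (k : C) m n, nabla Y (k *c m + n) = k *c nabla Y m + nabla Y n
    & forall d m f,
        nabla (TX q d) (m *r f) =
        nabla (TX q d) m *r (sigma q d |> f) + m *r (X q d |> f)].

Definition compatible (h : hermitian_form) (nabla : TS q -> M -> M) : Prop :=
  forall m1 m2,
  [/\ X q Plus |> h m1 m2 =
        h m1 (nabla (TX q Plus) m2)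
        - (gen_K q ^+ 2 |> h (nabla (TX q Minus) m1) m2),
      X q Minus |> h m1 m2 =
        h m1 (nabla (TX q Minus) m2)
        - (gen_K q ^+ 2 |> h (nabla (TX q Plus) m1) m2)
    & X q Zed |> h m1 m2 =
        h m1 (nabla (TX q Zed) m2)
        - (gen_K q ^+ 4 |> h (nabla (TX q Zed) m1) m2)].

End Module.

Definition torsion_free (nabla : TS q -> Omega1 q -> Omega1 q) : Prop :=
  let nb d e := nabla (TX q d) (omega q e) in
  let q' := qC q in
  [/\ nb Minus Plus - q' ^+ 2 *c nb Plus Minus = omega q Zed,
      q' ^+ 2 *c nb Zed Minus - q' ^- 2 *c nb Minus Zed =
        (1 + q' ^+ 2) *c omega q Minus
    & q' ^+ 2 *c nb Plus Zed - q' ^- 2 *c nb Zed Plus =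
        (1 + q' ^+ 2) *c omega q Plus].

Definition levi_civita (h : hermitian_form (Omega1 q))
    (nabla : TS q -> Omega1 q -> Omega1 q) : Prop :=
  [/\ right_affine_connection nabla, torsion_free nabla & compatible h nabla].

End Connections.

(* Main.v *)
From HB Require Import structures.
Require Import Defs.
From mathcomp Require Import all_boot all_order all_algebra.
From mathcomp Require Import boolp reals complex.
From mathcomp Require Import ring.

Set Implicit Arguments.
Unset Strict Implicit.
Unset Printing Implicit Defensive.

Import Order.TTheory GRing.Theory Num.Theory.
Local Open Scope ring_scope.

(* As h is invertible, a connection on the free module Omega^1 amounts to an  *)
(* arbitrary choice of the 27 elements G d b c = h(omega_b, nabla_d omega_c), *)
(* and being Levi-Civita becomes a system of equations on these. In this      *)
(* system only the diagonal entries are overdetermined: compatibility fixes   *)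
(* the skew parts x - K^4(x^* ) of G_z;-- and G_z;++, while torsion and       *)
(* compatibility link these two elements through the chain                    *)
(* G_z;-- -> G_-;-z -> G_+;z- -> G_-;z+ -> G_+;+z -> G_z;++.                  *)
(* Comparing skew parts along the chain gives exactly the stated identity;    *)
(* all other equations can be solved one after another.                       *)

(** The involution and the action satisfy sigma_d(star (sigma_d f)) = star f and sigma_d(star
    (X_{bar d} f)) = -X_d(star f), where bar exchanges + and -. Hence compatibility on the basis
    spreads to all of Omega^1 ([compatible_rmul]), and with h invertible the problem becomes a
    finite system for the elements G d b c ([levi_civita_coefP]). X_z-compatibility at a diagonal
    place reads [skew] G_z;bb = X_z(h_bb). By [diagonal_chain], the torsion and X_+ equations
    together with the X_z-equation at -- make the defect of the X_z-equation at ++ equal to q^4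
    times right side minus left side of the stated identity. As q is nonzero, the identity is
    necessary. Conversely, the explicit [coefs] solve all equations except possibly the X_z-equation
    at ++ ([coefs_torsion_free], [coefs_compatible]), and the same chain derives that one from the
    identity. *)

Section ActionStar.
Context (R : realType) (q : qparam R).
Local Notation A := (S3q q).
Local Notation K := (gen_K q).
Implicit Types (x y f : A) (u : Uq q).

HB.instance Definition _ u := GRing.isNmodMorphism.Build A A (act u)
  (conj (scale0_op (actZr u)) (actDr u)).

Lemma star_is_nmod_morphism : nmod_morphism (@star R q).
Proof. by split; [rewrite -(scale0r (0 : A)) starZ rmorph0 !scale0r | exact: starD]. Qed.

HB.instance Definition _ := GRing.isNmodMorphism.Build A A (@star R q)
  star_is_nmod_morphism.

Lemma conj_sqrtqC : (sqrtqC q)^* = sqrtqC q.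
Proof. by apply/CrealP; rewrite complex_real. Qed.

Lemma conj_sqrtqCV : ((sqrtqC q)^-1)^* = (sqrtqC q)^-1.
Proof. by rewrite fmorphV /= conj_sqrtqC. Qed.

Lemma conj_kappa : ((1 - qC q ^- 2)^-1)^* = (1 - qC q ^- 2)^-1.
Proof. by rewrite fmorphV rmorphB rmorph1 /= fmorphV rmorphXn /= conj_qC. Qed.

Lemma star_K f : star (K_op f) = Ki_op (star f).
Proof.
have s0 := sqrtqC_neq0 q.
elim/S3q_ind: f => [k|||||x y IHx IHy|x y IHx IHy].
- by rewrite K_opZ K_op1 !starZ star1 Ki_opZ Ki_op1.
- by rewrite K_gensE starZ star_a Ki_gensE conj_sqrtqCV.
- by rewrite K_gensE starZ star_as Ki_gensE conj_sqrtqC.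
- by rewrite K_gensE starZ star_c Ki_gensE conj_sqrtqCV.
- by rewrite K_gensE starZ star_cs Ki_gensE conj_sqrtqC.
- by rewrite K_opD !starD Ki_opD IHx IHy.
- by rewrite K_opM !starM Ki_opM IHx IHy.
Qed.

Lemma star_Ki f : star (Ki_op f) = K_op (star f).
Proof. by rewrite -{2}[f]Ki_opK star_K Ki_opK. Qed.

Lemma star_E f : star (E_op f) = - qC q *: F_op (star f).
Proof.
have q0 := qC_neq0 q; have E0 := scale0_op (@E_opZ R q).
elim/S3q_ind: f => [k|||||x y IHx IHy|x y IHx IHy].
- by rewrite E_opZ !starZ F_opZ E_op1 star1 F_op1 raddf0 !scaler0.
- by rewrite E_gensE starZ star_a star_cs F_gensE rmorphN /= conj_qC.
- by rewrite E_gensE star_as F_gensE raddf0 scaler0.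
- rewrite E_gensE star_c star_as F_gensE scalerA mulrNN mulfV ?scale1r //.
- by rewrite E_gensE star_cs F_gensE raddf0 scaler0.
- by rewrite E_opD !starD F_opD IHx IHy scalerDr.
- rewrite E_opM starM starD !starM F_opM IHx IHy star_K star_Ki.
  by rewrite -scalerAl -scalerAr -scalerDr addrC.
Qed.

Lemma star_F f : star (F_op f) = - (qC q)^-1 *: E_op (star f).
Proof.
have q0 := qC_neq0 q.
rewrite -[E_op _]starK star_E starK starZ scalerA rmorphN /= conj_qC mulrNN.
by rewrite mulVf ?scale1r.
Qed.

Definition dir_bar (d : dir) : dir :=
  match d with Plus => Minus | Minus => Plus | Zed => Zed end.

Lemma sigma_star_sigma d f :
  sigma q d |> star (sigma q d |> f) = star f.
Proof.
by case: d; rewrite /sigma !exprS expr0 !actM !act1 !act_K !star_K !Ki_opK.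
Qed.

(** Conjugating by [star] turns K into its inverse, E into -qF and F into -q^-1 E, so it exchanges
    X_+ and X_- up to sign and a power of K. This is why compatibility pairs nabla_+ with
    nabla_-. *)
Lemma sigma_star_X d f :
  sigma q d |> star (X q (dir_bar d) |> f) = - (X q d |> star f).
Proof.
have s0 := sqrtqC_neq0 q; have qs := sqrtqC2 q.
case: d; rewrite /sigma /X /=.
- rewrite expr2 !(actZl, actM) !(act_E, act_F, act_K) starZ star_F star_K.
  rewrite !(K_opZ, KE_op) !Ki_opK conj_sqrtqCV !scalerA -scaleNr.
  by congr (_ *: _); rewrite -qs; field.
- rewrite expr2 !(actZl, actM) !(act_E, act_F, act_K) starZ star_E star_K.
  rewrite !(K_opZ, KF_op) !Ki_opK conj_sqrtqC !scalerA -scaleNr.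
  by congr (_ *: _); rewrite -qs; field.
- have kr : ((1 - qC q ^- 2)^-1)^* = (1 - qC q ^- 2)^-1.
    by rewrite fmorphV rmorphB rmorph1 /= fmorphV rmorphXn /= conj_qC.
  have actB g : (1 - K ^+ 4) |> g = g - (K ^+ 4 |> g).
    by rewrite -scaleN1r actDl actZl act1 scaleN1r.
  rewrite !actZl !actB starZ conj_kappa actZr -scalerN; congr (_ *: _).
  by rewrite opprB [star _]raddfB [_ |> _]raddfB /= (sigma_star_sigma Zed).
Qed.

End ActionStar.

(** * Linear independence of X_+, X_-, X_z and coordinates on the tangent space *)

Section TangentFree.
Context (R : realType) (q : qparam R).
Local Notation C := R[i].
Local Notation A := (S3q q).

(** The action detects it: c = 0 forces a^* = E(c) = 0, and then 1 = a^* a + c^* c = 0. *)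
Lemma gen_c_neq0 : gen_c q != 0.
Proof.
apply/eqP => c0; have := @mul_asa R q.
have as0 : gen_as q = 0.
  by rewrite -(E_gensE q).1.1.2 c0 scale0_op //; exact: E_opZ.
rewrite c0 as0 mul0r mulr0 subr0 => /esym/eqP.
by rewrite oner_eq0.
Qed.

Lemma gen_a_neq0 : gen_a q != 0.
Proof.
apply: contra_neq gen_c_neq0 => a0; have := (E_gensE q).1.1.1.
rewrite a0 (scale0_op (@E_opZ R q)) => /esym/eqP.
rewrite scaler_eq0 oppr_eq0 (negPf (qC_neq0 q)) /= => /eqP cs0.
by rewrite -star_cs cs0 raddf0.
Qed.

(** The operator q^(1/2) K - 1 kills x and multiplies y by q - 1, which is nonzero. *)
Lemma weight_free (k l : C) (x y : A) :
    K_op x = (sqrtqC q)^-1 *: x -> K_op y = sqrtqC q *: y -> x != 0 -> y != 0 ->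
  k *: x + l *: y = 0 -> k = 0 /\ l = 0.
Proof.
move=> Kx Ky x0 y0 xy0; have s0 := sqrtqC_neq0 q.
have l0 : l = 0.
  have : sqrtqC q *: K_op (k *: x + l *: y) - (k *: x + l *: y) = 0.
    by rewrite xy0 (scale0_op (@K_opZ R q)) scaler0 subr0.
  rewrite K_opD !K_opZ Kx Ky scalerDr !scalerA opprD addrACA.
  rewrite mulrAC mulfV // mul1r subrr add0r -scalerBl => /eqP.
  rewrite scaler_eq0 (negPf y0) orbF mulrAC sqrtqC2 -[X in _ - X]mul1r -mulrBl.
  rewrite mulf_eq0 subr_eq0 orbC; case/orP=> /eqP // q1.
  by have := qC2_neq1 q; rewrite q1 expr1n eqxx.
split=> //; move: xy0; rewrite l0 scale0r addr0 => /eqP.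
by rewrite scaler_eq0 (negPf x0) orbF => /eqP.
Qed.

(* Connections are C-linear in the tangent vector, so prescribing one on X_+,  *)
(* X_- and X_z requires their independence; it is tested on a and a^*.        *)
Lemma X_free (k : dir -> C) : \sum_d k d *: X q d = 0 -> forall d, k d = 0.
Proof.
rewrite sum_dir => k0; have s0 := sqrtqC_neq0 q; have q0 := qC_neq0 q.
have Xg := X_gens q; cbv zeta in Xg.
have act0 f : (k Plus *: X q Plus + k Minus *: X q Minus + k Zed *: X q Zed) |> f = 0.
  by rewrite k0 -(scale0r (0 : Uq q)) actZl scale0r.
have cs0 : gen_cs q != 0.
  by apply: contra_neq gen_c_neq0 => cs0; rewrite -star_cs cs0 raddf0.
have as0 : gen_as q != 0.
  by apply: contra_neq gen_a_neq0 => as0; rewrite -star_as as0 raddf0.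
have [kz kp] : k Zed = 0 /\ - (k Plus * qC q) = 0.
  apply: (weight_free (K_gensE q).1.1.1 (K_gensE q).2 gen_a_neq0 cs0).
  move: (act0 (gen_a q)); rewrite !actDl !(actZl (k _)) !Xg scaler0 addr0 addrC.
  by rewrite scalerA mulrN.
have [km _] : k Minus = 0 /\ - (k Zed * qC q ^+ 2) = 0.
  apply: (weight_free (K_gensE q).1.1.2 (K_gensE q).1.2 gen_c_neq0 as0).
  move: (act0 (gen_as q)); rewrite !actDl !(actZl (k _)) !Xg scaler0 add0r.
  by rewrite scalerA mulrN.
move/eqP: kp; rewrite oppr_eq0 mulf_eq0 (negPf q0) orbF => /eqP kp.
by case.
Qed.

Lemma TS_coord_exists (Y : TS q) : exists k : dir -> C, TSval Y = \sum_d k d *: X q d.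
Proof. exact/asboolP/TSvalP. Qed.

(** A tangent vector is only known to lie in a span, so its coordinates are chosen classically;
    [X_free] makes them unique. *)
Definition TS_coord (Y : TS q) : dir -> C := projT1 (cid (TS_coord_exists Y)).

Lemma TS_coordE (Y : TS q) (k : dir -> C) :
  TSval Y = \sum_d k d *: X q d -> TS_coord Y = k.
Proof.
rewrite /TS_coord; case: cid => l /= -> /eqP; rewrite -subr_eq0 -sumrB => /eqP lk.
apply/funext => d; apply/eqP; rewrite -subr_eq0; apply/eqP.
apply: (X_free (k := fun d => l d - k d)); rewrite -[RHS]lk.
by apply: eq_bigr => e _; rewrite scalerBl.
Qed.

Lemma TS_coordP (k : C) (Y Z : TS q) d :
  TS_coord (k *: Y + Z) d = k * TS_coord Y d + TS_coord Z d.
Proof.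
rewrite (TS_coordE (k := fun d => k * TS_coord Y d + TS_coord Z d)) //=.
have coordK W : TSval W = \sum_d TS_coord W d *: X q d.
  by rewrite /TS_coord; case: cid.
rewrite -[LHS]/(k *: TSval Y + TSval Z) (coordK Y) (coordK Z) scaler_sumr -big_split.
by apply: eq_bigr => e _; rewrite scalerDl scalerA.
Qed.

Lemma TS_coord_X d e : TS_coord (TX q d) e = (e == d)%:R.
Proof.
rewrite (TS_coordE (k := fun e => (e == d)%:R)) //=.
rewrite (bigD1 d) //= eqxx scale1r big1 ?addr0 // => i /negPf->.
by rewrite scale0r.
Qed.

End TangentFree.

(** * Hermitian forms and compatibility on right modules *)

Section RightModule.
Context (R : realType) (q : qparam R) (M : lmodType (S3q q)^c).
Local Notation C := R[i].
Local Notation A := (S3q q).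
Implicit Types (m n : M) (f g : A) (k : C) (h : hermitian_form M).

Lemma rmulDl m n f : (m + n) *r f = m *r f + n *r f.
Proof. exact: scalerDr. Qed.

Lemma rmulDr m f g : m *r (f + g) = m *r f + m *r g.
Proof. exact: scalerDl. Qed.

Lemma rmulA m f g : m *r f *r g = m *r (f * g).
Proof. exact: scalerA. Qed.

Lemma rmul_suml I r (P : pred I) (F : I -> M) f :
  (\sum_(i <- r | P i) F i) *r f = \sum_(i <- r | P i) F i *r f.
Proof. exact: scaler_sumr. Qed.

Lemma cmulD k m n : k *c (m + n) = k *c m + k *c n.
Proof. exact: rmulDl. Qed.

Lemma cmul_sum k I r (P : pred I) (F : I -> M) :
  k *c (\sum_(i <- r | P i) F i) = \sum_(i <- r | P i) k *c F i.
Proof. exact: rmul_suml. Qed.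

Lemma cmulM k l m : (k * l) *c m = k *c (l *c m).
Proof. by rewrite /cmul rmulA -scalerAl mul1r scalerA mulrC. Qed.

Lemma cmulDl k l m : (k + l) *c m = k *c m + l *c m.
Proof. by rewrite /cmul scalerDl rmulDr. Qed.

Lemma cmul1 m : 1 *c m = m.
Proof. by rewrite /cmul scale1r; exact: scale1r. Qed.

Lemma cmul0 m : 0 *c m = 0.
Proof. by rewrite /cmul scale0r; exact: scale0r. Qed.

Lemma hformDr h m n1 n2 : h m (n1 + n2) = h m n1 + h m n2.
Proof. by rewrite -hform_star hformDl starD !hform_star. Qed.

Lemma hform_nmodr h m : nmod_morphism (h m).
Proof.
split; last exact: hformDr.
by apply: (@addrI _ (h m 0)); rewrite -hformDr !addr0.
Qed.

HB.instance Definition _ h m :=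
  GRing.isNmodMorphism.Build M A (h m) (hform_nmodr h m).

Lemma hform_cmulr h m n k : h m (k *c n) = k *: h m n.
Proof. by rewrite hform_rmul -scalerAr mulr1. Qed.

Lemma hform_rmull h m n f : h (m *r f) n = star f * h m n.
Proof. by rewrite -hform_star hform_rmul starM hform_star. Qed.

Lemma hform_sumr h m I r (P : pred I) (F : I -> M) :
  h m (\sum_(i <- r | P i) F i) = \sum_(i <- r | P i) h m (F i).
Proof. exact: raddf_sum. Qed.

Lemma act_sum (u : Uq q) I r (P : pred I) (F : I -> A) :
  u |> (\sum_(i <- r | P i) F i) = \sum_(i <- r | P i) (u |> F i).
Proof. exact: raddf_sum. Qed.

Lemma hform_suml h I r (P : pred I) (F : I -> M) n :
  h (\sum_(i <- r | P i) F i) n = \sum_(i <- r | P i) h (F i) n.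
Proof.
rewrite -hform_star raddf_sum raddf_sum.
by apply: eq_bigr => i _; rewrite /= hform_star.
Qed.

Lemma compatibleP h (nabla : TS q -> M -> M) :
  compatible h nabla <-> forall d m1 m2,
    X q d |> h m1 m2 = h m1 (nabla (TX q d) m2)
      - (sigma q d |> h (nabla (TX q (dir_bar d)) m1) m2).
Proof.
split=> [comp d m1 m2|comp m1 m2]; first by case: (comp m1 m2); case: d.
by split; [apply: (comp Plus) | apply: (comp Minus) | apply: (comp Zed)].
Qed.

(** In the Leibniz expansion, [sigma_star_X] identifies X_d(star f) with the contribution of X_{bar
    d}(f) in the first argument, and [sigma_star_sigma] restores star f as a left factor.
    Compatibility therefore need only be tested on generators. *)
Lemma compatible_rmul h (nabla : TS q -> M -> M) d m n f g :
    right_affine_connection nabla ->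
    X q d |> h m n = h m (nabla (TX q d) n)
      - (sigma q d |> h (nabla (TX q (dir_bar d)) m) n) ->
  X q d |> h (m *r f) (n *r g) = h (m *r f) (nabla (TX q d) (n *r g))
      - (sigma q d |> h (nabla (TX q (dir_bar d)) (m *r f)) (n *r g)).
Proof.
move=> [_ _ nabM] comp; rewrite !nabM hform_rmull hformDl !hform_rmull.
rewrite hformDr !hform_rmul.
have -> : sigma q (dir_bar d) = sigma q d by case: d {comp}.
rewrite actDr !act_sigmaM sigma_star_sigma sigma_star_X.
rewrite !act_XM comp !act_sigmaM mulNr opprD opprK addrA -mulrBr mulrBl.
by congr (star f * _ + _); rewrite addrCA addrA.
Qed.

End RightModule.

(** * Right coordinates on Omega^1 and the use of invertibility *)

Section Coordinates.
Context (R : realType) (q : qparam R).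
Local Notation C := R[i].
Local Notation A := (S3q q).
Local Notation O := (Omega1 q).
Implicit Types (m n w : O) (f g : A) (h : hermitian_form O).

Definition sigmaV (d : dir) : Uq q :=
  match d with Plus | Minus => gen_Ki q ^+ 2 | Zed => gen_Ki q ^+ 4 end.

Lemma sigmaK d f : sigmaV d |> (sigma q d |> f) = f.
Proof.
by case: d; rewrite /sigma /sigmaV !exprS expr0 !actM !act1 !act_K !act_Ki !K_opK.
Qed.

Lemma sigmaVK d f : sigma q d |> (sigmaV d |> f) = f.
Proof.
by case: d; rewrite /sigma /sigmaV !exprS expr0 !actM !act1 !act_K !act_Ki !Ki_opK.
Qed.

Lemma sigmaVM d f g : sigmaV d |> (f * g) = (sigmaV d |> f) * (sigmaV d |> g).
Proof. by case: d; rewrite /sigmaV !exprS expr0 !actM !act1 !act_KiM. Qed.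

Lemma sigma_const d (k : C) : sigma q d |> k%:A = k%:A.
Proof. by rewrite actZr act_sigma1. Qed.

Lemma X_const d (k : C) : X q d |> k%:A = 0.
Proof.
suff X1 : X q d |> 1 = 0 by rewrite actZr X1 scaler0.
have := act_XM d (1 : A) 1; rewrite act_sigma1 !mulr1 mul1r => /esym/eqP.
by rewrite -subr_eq0 addrK => /eqP.
Qed.

(** Since omega_d f = sigma_d(f) omega_d, a left coefficient becomes a right one through the inverse
    of sigma_d. *)
Definition rcoord (d : dir) (w : O) : A := sigmaV d |> w d.

Lemma rcoordD d : {morph rcoord d : v w / v + w}.
Proof. by move=> v w; rewrite /rcoord ffunE actDr. Qed.

Lemma rcoord_rmul d w f : rcoord d (w *r f) = rcoord d w * f.
Proof. by rewrite /rcoord rmulOE sigmaVM sigmaK. Qed.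

Lemma rcoord_omega d e : rcoord d (omega q e) = (d == e)%:R.
Proof.
rewrite /rcoord ffunE; case: eqP => _; last exact: raddf0.
by have := sigmaK d 1; rewrite act_sigma1.
Qed.

Lemma rcoordE w : w = \sum_d omega q d *r rcoord d w.
Proof.
rewrite [LHS]Omega1_basis; apply: eq_bigr => d _.
by rewrite omega_rmul sigmaVK.
Qed.

Section Functional.
Context (phi : dir -> A).

Definition functional (w : O) : (A^c)^o := \sum_d phi d * rcoord d w.

Lemma functional_linear : linear functional.
Proof.
move=> f v w; rewrite /functional -/(rmul v f).
under eq_bigr do rewrite rcoordD rcoord_rmul mulrDr mulrA.
by rewrite big_split /= -mulr_suml.
Qed.

HB.instance Definition _ :=
  GRing.isLinear.Build A^c O (A^c)^o *:%R functional functional_linear.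

End Functional.

Lemma invertible_surj h : invertible h ->
  forall phi : dir -> A, exists m, forall n, h m n = \sum_d phi d * rcoord d n.
Proof.
case=> g _ gK phi; exists (g (functional phi : dual O)) => n.
by rewrite -[h _ n]/(hat h _ n) gK.
Qed.

(** Invertibility prescribes the functional h(m, -); prescribing the starred values gives control of
    the second argument instead. *)
Lemma invertible_coef h : invertible h ->
  forall phi : dir -> A, exists m, forall d, h (omega q d) m = phi d.
Proof.
move=> /invertible_surj/[swap] phi /(_ (fun d => star (phi d)))[m mP].
exists m => d; rewrite -hform_star mP (bigD1 d) //= rcoord_omega eqxx mulr1.
rewrite big1 ?addr0 ?starK // => e /negPf ed.
by rewrite rcoord_omega ed mulr0.
Qed.

Lemma hform_omega_inj h : invertible h ->
  forall m n, (forall d, h (omega q d) m = h (omega q d) n) -> m = n.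
Proof.
move=> h_inv m n mn.
have hmn w : h w m = h w n.
  by rewrite (rcoordE w) !hform_suml; apply: eq_bigr => d _; rewrite !hform_rmull mn.
rewrite (rcoordE m) (rcoordE n); apply: eq_bigr => d _; congr (_ *r _).
(* This [w] represents the d-th right coordinate, so the values of h recover the coordinates of m
   and n. *)
have [w wP] := invertible_surj h_inv (fun e => (e == d)%:R).
have coordE v : h w v = rcoord d v.
  rewrite wP (bigD1 d) //= eqxx mul1r big1 ?addr0 // => e /negPf->.
  by rewrite mul0r.
by rewrite -!coordE.
Qed.

End Coordinates.

(** * Connections with prescribed values on the basis *)

Section ConnectionOfCoefficients.
Context (R : realType) (q : qparam R).
Local Notation O := (Omega1 q).
Context (N : dir -> dir -> O).

(** The formula forced by additivity and the Leibniz rule once omega_c is sent to N d c. *)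
Definition dir_conn (d : dir) (m : O) : O :=
  \sum_c (N d c *r (sigma q d |> rcoord c m) + omega q c *r (X q d |> rcoord c m)).

Definition conn_of (Y : TS q) (m : O) : O := \sum_d TS_coord Y d *c dir_conn d m.

Lemma dir_connD d : {morph dir_conn d : m n / m + n}.
Proof.
move=> m n; rewrite /dir_conn -big_split; apply: eq_bigr => c _ /=.
by rewrite rcoordD !actDr !rmulDr addrACA.
Qed.

Lemma dir_connM d m f :
  dir_conn d (m *r f) = dir_conn d m *r (sigma q d |> f) + m *r (X q d |> f).
Proof.
rewrite {3}(rcoordE m) /dir_conn !rmul_suml -big_split; apply: eq_bigr => c _ /=.
rewrite rcoord_rmul act_sigmaM act_XM !rmulDr rmulDl !rmulA -!addrA.
by congr (_ + _); rewrite addrC.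
Qed.

Lemma dir_connZ d k m : dir_conn d (k *c m) = k *c dir_conn d m.
Proof. by rewrite dir_connM sigma_const X_const [X in _ + X]scale0r addr0. Qed.

Lemma dir_conn_omega d c : dir_conn d (omega q c) = N d c.
Proof.
rewrite /dir_conn (bigD1 c) //= rcoord_omega eqxx act_sigma1.
have := X_const q d 1; rewrite scale1r => ->.
rewrite [_ *r 1]scale1r [_ *r 0]scale0r addr0 big1 ?addr0 // => e /negPf ec.
by rewrite rcoord_omega ec !raddf0 [N d e *r 0]scale0r [_ *r 0]scale0r addr0.
Qed.

Lemma conn_of_X d m : conn_of (TX q d) m = dir_conn d m.
Proof.
rewrite /conn_of (bigD1 d) //= TS_coord_X eqxx cmul1 big1 ?addr0 //.
by move=> e /negPf ed; rewrite TS_coord_X ed cmul0.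
Qed.

Lemma conn_of_right_affine : right_affine_connection conn_of.
Proof.
split=> [k Y Z m|Y k m n|d m f]; last by rewrite !conn_of_X dir_connM.
- rewrite /conn_of cmul_sum -big_split; apply: eq_bigr => d _ /=.
  by rewrite TS_coordP cmulDl cmulM.
- rewrite /conn_of cmul_sum -big_split; apply: eq_bigr => d _ /=.
  by rewrite dir_connD dir_connZ cmulD -!cmulM mulrC.
Qed.

End ConnectionOfCoefficients.

(** * Levi-Civita connections as solutions of a coefficient system *)

Section Coefficients.
Context (R : realType) (q : qparam R).
Local Notation A := (S3q q).
Local Notation O := (Omega1 q).
Context (h : hermitian_form O).
Local Notation hh d e := (h (omega q d) (omega q e)).

(** The star and the swapped indices come from h(nabla_{bar d} omega_b, omega_c) being the star of
    h(omega_c, nabla_{bar d} omega_b). *)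
Definition coef_compatible (G : dir -> dir -> dir -> A) : Prop :=
  forall d b c, X q d |> hh b c =
    G d b c - (sigma q d |> star (G (dir_bar d) c b)).

Definition coef_torsion_free (G : dir -> dir -> dir -> A) : Prop :=
  forall b,
  [/\ G Minus b Plus - qC q ^+ 2 *: G Plus b Minus = hh b Zed,
      qC q ^+ 2 *: G Zed b Minus - qC q ^- 2 *: G Minus b Zed =
        (1 + qC q ^+ 2) *: hh b Minus
    & qC q ^+ 2 *: G Plus b Zed - qC q ^- 2 *: G Zed b Plus =
        (1 + qC q ^+ 2) *: hh b Plus].

(* G d b c stands for h(omega_b, nabla_d omega_c).                            *)
Lemma levi_civita_coefP : invertible h ->
  (exists nabla, levi_civita h nabla) <->
  (exists G, coef_compatible G /\ coef_torsion_free G).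
Proof.
move=> h_inv; split=> [[nabla [_ [T1 T2 T3] /compatibleP comp]]|[G [comp tors]]].
  exists (fun d b c => h (omega q b) (nabla (TX q d) (omega q c))).
  split=> [d b c|b]; first by rewrite hform_star comp.
  by split; rewrite -!hform_cmulr -raddfB /= ?(T1, T2, T3).
have /choice[N NP] : forall dc : dir * dir, exists m, forall b,
    h (omega q b) m = G dc.1 b dc.2.
  by move=> dc; apply: (invertible_coef h_inv (fun b => G dc.1 b dc.2)).
pose nabla := conn_of (fun d c => N (d, c)).
have nab : right_affine_connection nabla by exact: conn_of_right_affine.
have nabE d c b : h (omega q b) (nabla (TX q d) (omega q c)) = G d b c.
  by rewrite /nabla conn_of_X dir_conn_omega NP.
exists nabla; split=> //.
  split; apply: (hform_omega_inj h_inv) => b; have [T1 T2 T3] := tors b;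
    by rewrite raddfB /= !hform_cmulr !nabE.
apply/compatibleP => d m n.
have nab0 e : nabla (TX q e) 0 = 0.
  apply: (@addrI _ (nabla (TX q e) 0)); have [_ nabD _] := nab.
  have := nabD (TX q e) 1 0 0.
  by rewrite !cmul1 !addr0 => <-.
have nab_sum e I (r : seq I) (F : I -> O) :
    nabla (TX q e) (\sum_(i <- r) F i) = \sum_(i <- r) nabla (TX q e) (F i).
  apply: (big_morph _ _ (nab0 e)) => x y; have [_ nabD _] := nab.
  by have := nabD (TX q e) 1 x y; rewrite !cmul1.
(* Both arguments are expanded in right coordinates, which leaves basis elements times functions. *)
rewrite (rcoordE m) (rcoordE n) !nab_sum !hform_suml !act_sum -sumrB.
apply: eq_bigr => b _; rewrite !hform_sumr !act_sum -sumrB; apply: eq_bigr => c _.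
apply: compatible_rmul => //; rewrite nabE comp; congr (_ - (_ |> _)).
by rewrite -[RHS]hform_star nabE.
Qed.

End Coefficients.

(** * The obstruction on the diagonal entries *)

Section CoefficientSystem.
Context (R : realType) (q : qparam R).
Local Notation C := R[i].
Local Notation A := (S3q q).
Local Notation O := (Omega1 q).
Local Notation q' := (qC q).
Local Notation K := (gen_K q).
Context (h : hermitian_form O).
Local Notation hh d e := (h (omega q d) (omega q e)).

(** The map sending x to K^4(star x) is an involution, and [skew] removes its fixed part. At b = c
    the X_z-compatibility equation is a condition on [skew] of G_z;bb alone. *)
Definition skew (x : A) : A := x - (K ^+ 4 |> star x).

Lemma skewD : {morph skew : x y / x + y}.
Proof. by move=> x y; rewrite /skew starD actDr opprD addrACA. Qed.

Lemma skewZ (k : C) x : k^* = k -> skew (k *: x) = k *: skew x.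
Proof. by move=> kr; rewrite /skew starZ kr actZr scalerBr. Qed.

Lemma skew_herm x : star x = x -> skew x = (1 - q' ^- 2) *: (X q Zed |> x).
Proof.
move=> xs; have q1 : 1 - q' ^- 2 != 0.
  by rewrite subr_eq0 eq_sym invr_eq1 qC2_neq1.
rewrite /skew xs /= actZl scalerA mulfV // scale1r.
by rewrite actDl act1 -[- K ^+ 4]scaleN1r actZl scaleN1r.
Qed.

Lemma skew_X d x : d != Zed ->
  skew (X q d |> x) = (X q d |> x) + (K ^+ 2 |> (X q (dir_bar d) |> star x)).
Proof.
move=> dz; rewrite /skew; congr (_ + _).
rewrite -[4%N]/(2 + 2)%N exprD actM.
have -> : K ^+ 2 = sigma q d by case: d dz.
have -> : sigma q d |> star (X q d |> x) = - (X q (dir_bar d) |> star x).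
  by rewrite -sigma_star_X; case: d dz.
by rewrite raddfN opprK.
Qed.

(** Only y - star y survives, so a hermitian summand of y such as h_zz disappears. *)
Lemma skew_sigma_star y :
  skew (K ^+ 2 |> star y) = - (K ^+ 2 |> (y - star y)).
Proof.
rewrite /skew -[4%N]/(2 + 2)%N exprD actM (sigma_star_sigma Plus) starK.
by rewrite [K ^+ 2 |> (_ - _)]raddfB opprB.
Qed.

(* The hermitian parts of the intermediate terms drop out under skew.         *)
Lemma diagonal_chain (gzmm gmmz gpzm gmzp gppz gzpp : A) :
    q' ^+ 2 *: gzmm - q' ^- 2 *: gmmz = (1 + q' ^+ 2) *: hh Minus Minus ->
    X q Plus |> hh Zed Minus = gpzm - (K ^+ 2 |> star gmmz) ->
    gmzp - q' ^+ 2 *: gpzm = hh Zed Zed ->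
    X q Plus |> hh Plus Zed = gppz - (K ^+ 2 |> star gmzp) ->
    q' ^+ 2 *: gppz - q' ^- 2 *: gzpp = (1 + q' ^+ 2) *: hh Plus Plus ->
    skew gzmm = X q Zed |> hh Minus Minus ->
  skew gzpp - (X q Zed |> hh Plus Plus) = q' ^+ 4 *:
    ((K ^+ 2 |> (X q Minus |> hh Zed Plus)) - q' ^+ 2 *: (X q Minus |> hh Minus Zed)
     - q' ^+ 2 *: (K ^+ 2 |> (X q Plus |> hh Zed Minus)) + (X q Plus |> hh Plus Zed)
     - (X q Zed |> (hh Plus Plus - q' ^+ 2 *: hh Minus Minus))).
Proof.
have q0 := qC_neq0 q.
have qr n : (q' ^+ n)^* = q' ^+ n by rewrite rmorphXn /= conj_qC.
have q1r : (1 + q' ^+ 2)^* = 1 + q' ^+ 2 by rewrite rmorphD rmorph1 /= qr.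
move=> T2 C1 T1 C2 T3 Gzmm.
have gmmzE : gmmz = q' ^+ 4 *: gzmm + (- (q' ^+ 2 * (1 + q' ^+ 2))) *: hh Minus Minus.
  rewrite scaleNr -[(q' ^+ 2 * _) *: _]scalerA -T2 scalerBr !scalerA -exprD.
  by rewrite mulfV ?expf_neq0 // scale1r opprB addrC subrK.
have gzppE : gzpp = q' ^+ 4 *: gppz + (- (q' ^+ 2 * (1 + q' ^+ 2))) *: hh Plus Plus.
  rewrite scaleNr -[(q' ^+ 2 * _) *: _]scalerA -T3 scalerBr !scalerA -exprD.
  by rewrite mulfV ?expf_neq0 // scale1r opprB addrC subrK.
have kr : (- (q' ^+ 2 * (1 + q' ^+ 2)))^* = - (q' ^+ 2 * (1 + q' ^+ 2)).
  by rewrite rmorphN rmorphM /= qr q1r.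
(* The scalars combine as q^4 - q^2 (1 + q^2)(1 - q^-2) = 1. *)
have skmmz : skew gmmz = X q Zed |> hh Minus Minus.
  rewrite gmmzE skewD !skewZ ?qr ?kr // Gzmm skew_herm ?hform_star //.
  by rewrite scalerA -scalerDl -[RHS]scale1r; congr (_ *: _); field.
have {T1} gmzpE : gmzp = hh Zed Zed + q' ^+ 2 *: gpzm by rewrite -T1 subrK.
have gpzmE : gpzm = (X q Plus |> hh Zed Minus) + (K ^+ 2 |> star gmmz).
  by rewrite C1 subrK.
have gppzE : gppz = (X q Plus |> hh Plus Zed) + (K ^+ 2 |> star gmzp).
  by rewrite C2 subrK.
have imzp : K ^+ 2 |> (gmzp - star gmzp) = q' ^+ 2 *:
    ((K ^+ 2 |> (X q Plus |> hh Zed Minus)) + (X q Minus |> hh Minus Zed)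
      - (X q Zed |> hh Minus Minus)).
  rewrite -skmmz gmzpE starD hform_star starZ qr opprD addrACA subrr add0r.
  rewrite -scalerBr actZr; congr (_ *: _); rewrite gpzmE starD opprD.
  rewrite !actDr !raddfN /= (sigma_star_sigma Plus) starK (sigma_star_X Minus) opprK.
  rewrite hform_star addrACA; congr (_ + _).
  by rewrite -actM -exprD /skew opprB.
rewrite gzppE skewD !skewZ ?qr ?kr //.
rewrite (skew_herm (x := hh Plus Plus)) ?hform_star // gppzE skewD.
rewrite skew_X // skew_sigma_star imzp hform_star /=.
rewrite [X q Zed |> (_ - _)]raddfB /= actZr.
set Zp := X q Zed |> _; set Zm := X q Zed |> _; set a := X q Plus |> _.
set b := K ^+ 2 |> _; set c := K ^+ 2 |> _; set d := X q Minus |> _.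
(* Here [Zm] abbreviates X_z(h_++) and [Zp] abbreviates X_z(h_--). The scalar on the left is 1 -
   q^4; its part 1 cancels the subtracted X_z(h_++) and leaves a common factor q^4. *)
have -> : - (q' ^+ 2 * (1 + q' ^+ 2)) *: ((1 - q' ^- 2) *: Zm) = Zm + q' ^+ 4 *: (- Zm).
  rewrite scalerA scalerN -scaleNr -[X in _ = X + _]scale1r -scalerDl.
  by congr (_ *: _); field.
rewrite [Zm + _]addrC addrA addrK -scalerDr; congr (_ *: _).
rewrite !(scalerBr, scalerDr) !opprB !opprD !addrA.
by rewrite [RHS](ACl (4*1*5*3*2*6)%AC).
Qed.

(** * An explicit solution of the coefficient system *)

Local Notation kappa := ((1 - q' ^- 2)^-1).

(* The free coefficients of the solution are set to 0 or to kappa h_bc, which *)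
(* solves the X_z-compatibility equations since X_z = kappa (1 - K^4); all    *)
(* other entries of gm, gp and gz are then forced.                            *)
Definition gm (b c : dir) : A :=
  match b, c with
  | _, Zed => kappa *: hh b Minus
  | Plus, Minus | Minus, Minus => 0
  | Zed, Minus => (X q Minus |> hh Zed Minus)
      + (K ^+ 2 |> star (kappa *: hh Minus Plus))
  | Minus, Plus => hh Minus Zed + q' ^+ 2 *: (X q Plus |> hh Minus Minus)
  | Zed, Plus => hh Zed Zed + q' ^+ 2 *:
      ((X q Plus |> hh Zed Minus) + (K ^+ 2 |> star (kappa *: hh Minus Minus)))
  | Plus, Plus => hh Plus Zed + q' ^+ 2 *: ((X q Plus |> hh Plus Minus)
      + (K ^+ 2 |> star (hh Minus Zed + q' ^+ 2 *: (X q Plus |> hh Minus Minus))))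
  end.

Definition gp (b c : dir) : A := (X q Plus |> hh b c) + (K ^+ 2 |> star (gm c b)).

Definition gz (b c : dir) : A :=
  let gz_plus b := q' ^+ 4 *: gp b Zed - (q' ^+ 2 * (1 + q' ^+ 2)) *: hh b Plus in
  match b, c with
  | _, Plus => gz_plus b
  | _, Minus => kappa *: hh b Minus
  | Plus, Zed => (X q Zed |> hh Plus Zed) + (K ^+ 4 |> star (gz_plus Zed))
  | _, Zed => kappa *: hh b Zed
  end.

Definition coefs (d : dir) : dir -> dir -> A :=
  match d with Plus => gp | Minus => gm | Zed => gz end.

Lemma q2_sub1_neq0 : q' ^+ 2 - 1 != 0.
Proof. by rewrite subr_eq0 qC2_neq1. Qed.

(** The first and third equations are built into [gm] and [gz]. The second holds because kappa (q^2
    - q^-2) = 1 + q^2, so the choice suited to X_z-compatibility also suits torsion. *)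
Lemma coefs_torsion_free : coef_torsion_free h coefs.
Proof.
have q0 := qC_neq0 q; have q1 := q2_sub1_neq0.
have q1' : q' * q' - 1 != 0 by [].
move=> b; split.
- case: b; rewrite /coefs /gp /gm;
    by rewrite ?[star 0]raddf0 ?[_ |> 0]raddf0 ?addr0 addrK.
- rewrite -[coefs Zed b Minus]/(gz b Minus) -[coefs Minus b Zed]/(gm b Zed).
  have -> : gm b Zed = kappa *: hh b Minus by case: b.
  have -> : gz b Minus = kappa *: hh b Minus by case: b.
  by rewrite !scalerA -scalerBl; congr (_ *: _); field; rewrite q0 q1'.
- rewrite -[coefs Plus b Zed]/(gp b Zed) -[coefs Zed b Plus]/(gz b Plus).
  have -> : gz b Plus = q' ^+ 4 *: gp b Zed - (q' ^+ 2 * (1 + q' ^+ 2)) *: hh b Plus.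
    by case: b.
  rewrite scalerBr !scalerA opprB addrCA -scalerBl.
  rewrite [X in _ + X *: _](_ : _ = 0) ?scale0r ?addr0; last by field.
  by congr (_ *: _); field.
Qed.

Lemma kappa_herm b c :
  X q Zed |> hh b c = kappa *: hh b c - (K ^+ 4 |> star (kappa *: hh c b)).
Proof.
rewrite starZ conj_kappa hform_star actZr -scalerBr /= actZl; congr (_ *: _).
by rewrite actDl act1 -[- K ^+ 4]scaleN1r actZl scaleN1r.
Qed.

(** The value of [gm Zed Minus] is chosen for this: the third torsion equation then gives kappa h_-+
    for G_z;-+, the partner that X_z-compatibility needs for G_z;+- = kappa h_+-. *)
Lemma gp_minus_zed : gp Minus Zed = kappa *: hh Minus Plus.
Proof.
rewrite /gp /gm starD actDr (sigma_star_X Plus) (sigma_star_sigma Plus) starK.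
by rewrite hform_star addrA subrr add0r.
Qed.

(** The only equation not met by construction is the X_z-equation at ++, where both indices give the
    same, already determined, entry; hence the hypothesis. *)
Lemma coefs_compatible :
    skew (gz Plus Plus) = X q Zed |> hh Plus Plus -> coef_compatible h coefs.
Proof.
have q0 := qC_neq0 q; have q1' : q' * q' - 1 != 0 := q2_sub1_neq0.
move=> gzpp [] b c /=.
- by rewrite /gp addrK.
(* The X_- equation is the X_+ equation with its indices swapped, after applying star and then
   K^2. *)
- rewrite /gp starD actDr (sigma_star_X Minus) (sigma_star_sigma Plus) starK.
  by rewrite hform_star opprD opprK addrCA subrr addr0.
have gzmp : gz Minus Plus = kappa *: hh Minus Plus.
  rewrite /gz gp_minus_zed scalerA -scalerBl; congr (_ *: _).
  by field; rewrite q0 q1'.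
case: b; case: c; rewrite ?gzmp; try exact: kappa_herm.
- by rewrite -gzpp.
- by rewrite {1}/gz addrK.
- rewrite {2}/gz starD actDr (sigma_star_X Zed) (sigma_star_sigma Zed) starK.
  by rewrite hform_star opprD opprK addrCA subrr addr0.
Qed.

End CoefficientSystem.

Theorem proposition4p2 (R : realType) (q : qparam R)
    (h : hermitian_form (Omega1 q)) (h_inv : invertible h) :
  let hh d e := h (omega q d) (omega q e) in
  let q' := qC q in
  (exists nabla : TS q -> Omega1 q -> Omega1 q, levi_civita h nabla) <->
  X q Zed |> (hh Plus Plus - q' ^+ 2 *: hh Minus Minus) =
    (gen_K q ^+ 2 |> (X q Minus |> hh Zed Plus))
    - q' ^+ 2 *: (X q Minus |> hh Minus Zed)
    - q' ^+ 2 *: (gen_K q ^+ 2 |> (X q Plus |> hh Zed Minus))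
    + (X q Plus |> hh Plus Zed).
Proof.
move=> hh q'; have q0 := qC_neq0 q.
(* Stated as an equivalence for arbitrary G: one direction is applied to the coefficients of a given
   connection, the other to [coefs]. *)
have chain G : coef_torsion_free h G ->
    (forall b c, X q Plus |> hh b c = G Plus b c
       - (gen_K q ^+ 2 |> star (G Minus c b))) ->
    skew (G Zed Minus Minus) = X q Zed |> hh Minus Minus ->
  skew (G Zed Plus Plus) = X q Zed |> hh Plus Plus <->
  X q Zed |> (hh Plus Plus - q' ^+ 2 *: hh Minus Minus) =
    (gen_K q ^+ 2 |> (X q Minus |> hh Zed Plus))
    - q' ^+ 2 *: (X q Minus |> hh Minus Zed)
    - q' ^+ 2 *: (gen_K q ^+ 2 |> (X q Plus |> hh Zed Minus))
    + (X q Plus |> hh Plus Zed).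
  move=> tors compP Gmm; have [_ _ T3] := tors Plus; have [_ T2 _] := tors Minus.
  have [T1 _ _] := tors Zed.
  have := diagonal_chain T2 (compP Zed Minus) T1 (compP Plus Zed) T3 Gmm.
  rewrite -/hh -/q' => E; split=> [gpp|cond]; last first.
    by apply/eqP; rewrite -subr_eq0 E cond subrr scaler0.
  move/eqP: E; rewrite gpp subrr eq_sym scaler_eq0 expf_eq0 (negPf q0) /= subr_eq0.
  by move/eqP.
apply: (iff_trans (levi_civita_coefP h_inv)); split=> [[G [comp tors]]|cond].
  by apply/(chain G tors); [exact: (comp Plus) | exact/esym/(comp Zed)..].
have comp0 b c : X q Plus |> hh b c = coefs h Plus b c
    - (gen_K q ^+ 2 |> star (coefs h Minus c b)) by rewrite /= /gp addrK.
exists (coefs h); split; last exact: coefs_torsion_free.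
apply: coefs_compatible; apply/(chain (coefs h)) => //.
  exact: coefs_torsion_free.
by rewrite /skew -kappa_herm.
Qed.
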